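(* Let $J=(0,\infty)$ and $P(s)=\ln s$ for all $s\in J$. Let $A:U_\infty\to\mathcal M^{n\times n}_{\rm sym}$, $K:U_\infty\to\mathcal M^{n\times n}$ and $B:U_\infty\times J\to\mathbb R^n$ be such that, for some constants $c_0>0$, $M_1>0$, $c_1\ge0$, $c_2\ge0$ and for all $(x,t)\in U_\infty$, $\xi\in\mathbb R^n$, $$\xi^{\rm T}A(x,t)\xi\ge c_0|\xi|^2,\qquad{\rm Tr}(A(x,t))\le M_1,\qquad -c_1|\xi|^2\le\xi^{\rm T}K(x,t)\xi\le c_2|\xi|^2 .$$ Let $u\in C(\overline{U_\infty})\cap C^{2,1}_{x,t}(U_\infty)$, with $u(U_\infty)\subset J$, be a solution of the problem $$Lu=f\ \text{ in }U\times(0,\infty),\qquad u=g\ \text{ on }\Gamma\times(0,\infty),\qquad u(x,0)=u_0(x)\ \text{ in }U,$$ where $f:U_\infty\to\mathbb R$, $g:\Gamma\times(0,\infty)\to\mathbb R$, $u_0:U\to\mathbb R$ are given functions. Assume: (a) There is a continuous, increasing function $\bar b:[0,\infty)\to[0,\infty)$ which tends to infinity as $t\to\infty$, and a number $\gamma_0>0$ such that $|B(x,t,s)|\le\bar b(t)(1+|s|)^{\gamma_0}$ for all $(x,t)\in U_\infty$ and $s\in J$. (b) There is a continuous function $F:[0,\infty)\to[0,\infty)$ such that $|f(x,t)|\le F(t)$ for all $(x,t)\in U_\infty$, and $\int_0^\infty F(\tau)\,{\rm d}\tau=\infty$. Suppose there exist a positive number $\lambda_1\ge c_1/c_0$ and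 two continuous functions $\mathcal F(t)$ and $\widetilde\Lambda(t)$ defined for sufficiently large $t$ such that the following are satisfied. (i) The function $\mathcal F(t)$ is increasing and, for sufficiently large $t$, $\int_0^tF(\tau)\,{\rm d}\tau\le\mathcal F(t)$. (ii) The function $\widetilde\Lambda(t)$ is decreasing and, for sufficiently large $t$, $$\max_{(x,\tau)\in\Gamma\times[t,t+1]}|g(x,\tau)|+\int_t^{t+1}F(\tau)\mathcal F(\tau)^{\lambda_1}\,{\rm d}\tau\le\widetilde\Lambda(t).$$ (iii) For any $\mu>0$, the functions $z_0(t):=\mu\bar b(t)\mathcal F(t)^{\gamma_0}$ and $\bar\Lambda(t):=\widetilde\Lambda(t/4)$ satisfy Condition (Z) (see context) and $\limsup_{t\to\infty}\left(\bar\Lambda(t)e^{\frac{d}{c_0}z_0(t)}\right)=0$. Then $$\lim_{t\to\infty}\left\{\max_{x\in\bar U}u(x,t)\right\}=0.$$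
   Context: $n\ge1$ is fixed; $U$ is a non-empty, open, bounded subset of $\mathbb R^n$ with boundary $\Gamma$, closure $\bar U$ and diameter $d=\max\{|x-x'|:x,x'\in\bar U\}$. $U_\infty=U\times(0,\infty)$, $\overline{U_\infty}=\bar U\times[0,\infty)$. $\mathcal M^{n\times n}$ (resp. $\mathcal M^{n\times n}_{\rm sym}$) is the set of real (resp. real symmetric) $n\times n$ matrices. $C^{2,1}_{x,t}(U\times I)$ is the class of continuous functions on $U\times I$ with continuous partial derivatives $\partial u/\partial t$, $\partial u/\partial x_i$, $\partial^2u/\partial x_i\partial x_j$. $\langle A,B\rangle={\rm Tr}(A^{\rm T}B)$; $D^2u$, $\nabla u$ are the Hessian and gradient in $x$. ''Increasing'', ''decreasing'', ''monotone'' are in the non-strict sense. The nonlinear operator $L$ is $$Lu=\frac{\partial u}{\partial t}-\langle A(x,t),D^2u\rangle+B(x,t,u)\cdot\nabla u+P'(u)(K(x,t)\nabla u)\cdot\nabla u.$$ Condition (Z): two nonnegative functions $z_0(t)$ and $\bar\Lambda(t)$, defined for sufficiently large $t$, satisfy Condition (Z) if there are numbers $T^*\ge0$, $t_*\ge4T^*$ and $\varepsilon_*>0$ such that $\int_{T^*}^\infty e^{-\frac{d}{c_0}z_0(x)}\,{\rm d}x=\infty$ and, for any $\varepsilon\in(0,\varepsilon_* )$, the function $$t\in[t_*,\infty)\mapsto\bar\Lambda(t)\exp\left(e^{-\frac{d^2}{2c_0}-\varepsilon}\int_{t_*}^{t+1}e^{-\frac{d}{c_0}z_0(x)}\,{\rm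 d}x\right)$$ is monotone. *)

(* Defs.v *)
From HB Require Import structures.
From mathcomp Require Import all_boot all_order all_algebra.
From mathcomp Require Import all_classical all_reals all_analysis.
Set Implicit Arguments.
Unset Strict Implicit.
Unset Printing Implicit Defensive.
Import Order.TTheory GRing.Theory Num.Theory.
Import numFieldNormedType.Exports.
Local Open Scope classical_set_scope.
Local Open Scope ring_scope.

(* Points of R^n are row vectors.  The library norm on 'rV[R]_n is the sup
   norm (it induces the usual topology); [dotv] and [enorm] are the Euclidean
   inner product and norm.  The matrix-vector product M v, with v seen as a
   column, is the row v *m M^T. *)

Definition dotv (R : realType) (n : nat) (v w : 'rV[R]_n) : R :=
  \sum_(i < n) v 0 i * w 0 i.

Definition enorm (R : realType) (n : nat) (v : 'rV[R]_n) : R :=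
  Num.sqrt (dotv v v).

Definition mulmxv (R : realType) (n : nat) (M : 'M[R]_n) (v : 'rV[R]_n)
  : 'rV[R]_n := v *m M^T.

(* [sup] is a real supremum with default value 0 on empty or unbounded sets.
   It is only applied to continuous functions on non-empty compact sets,
   where it is the maximum. *)
Definition max_over (R : realType) (T : Type) (D : set T) (h : T -> R) : R :=
  sup (h @` D).

Definition diameter (R : realType) (n : nat) (U : set 'rV[R]_n) : R :=
  max_over (closure U `*` closure U) (fun p => enorm (p.1 - p.2)).

Definition boundary (R : realType) (n : nat) (U : set 'rV[R]_n)
  : set 'rV[R]_n := closure U `\` interior U.

Definition partial_t (R : realType) (n : nat) (u : 'rV[R]_n -> R -> R)
  (x : 'rV[R]_n) (t : R) : R := derive1 (u x) t.

Definition partial_x (R : realType) (n : nat) (i : 'I_n)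
  (u : 'rV[R]_n -> R -> R) (x : 'rV[R]_n) (t : R) : R :=
  'D_(delta_mx 0 i) (fun y => u y t) x.

Definition grad_x (R : realType) (n : nat) (u : 'rV[R]_n -> R -> R)
  (x : 'rV[R]_n) (t : R) : 'rV[R]_n := \row_(i < n) partial_x i u x t.

Definition hess_x (R : realType) (n : nat) (u : 'rV[R]_n -> R -> R)
  (x : 'rV[R]_n) (t : R) : 'M[R]_n :=
  \matrix_(i < n, j < n) partial_x i (partial_x j u) x t.

Definition continuous_on (R : realType) (n : nat) (D : set ('rV[R]_n * R))
  (u : 'rV[R]_n -> R -> R) : Prop :=
  {within D, continuous (fun p : 'rV[R]_n * R => u p.1 p.2)}.

(* The class C^{2,1}_{x,t}(U x I), for U and I open. *)
Definition C21 (R : realType) (n : nat) (U : set 'rV[R]_n) (I : set R)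
  (u : 'rV[R]_n -> R -> R) : Prop :=
  [/\ continuous_on (U `*` I) u,
      (forall x t, U x -> I t ->
        [/\ derivable (u x) t 1,
            (forall i, derivable (fun y => u y t) x (delta_mx 0 i)) &
            (forall i j,
              derivable (fun y => partial_x j u y t) x (delta_mx 0 i))]),
      continuous_on (U `*` I) (partial_t u),
      (forall i, continuous_on (U `*` I) (partial_x i u)) &
      (forall i j, continuous_on (U `*` I) (partial_x i (partial_x j u)))].

Definition frob (R : realType) (n : nat) (M N : 'M[R]_n) : R :=
  \tr (M^T *m N).

Definition Lop (R : realType) (n : nat) (P : R -> R)
  (A K : 'rV[R]_n -> R -> 'M[R]_n) (B : 'rV[R]_n -> R -> R -> 'rV[R]_n)
  (u : 'rV[R]_n -> R -> R) (x : 'rV[R]_n) (t : R) : R :=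
  partial_t u x t
  - frob (A x t) (hess_x u x t)
  + dotv (B x t (u x t)) (grad_x u x t)
  + derive1 P (u x t) * dotv (mulmxv (K x t) (grad_x u x t)) (grad_x u x t).

Definition increasing_on (R : realType) (D : set R) (h : R -> R) : Prop :=
  {in D &, {homo h : s t / s <= t}}.

Definition decreasing_on (R : realType) (D : set R) (h : R -> R) : Prop :=
  {in D &, {homo h : s t /~ s <= t}}.

Definition monotone_on (R : realType) (D : set R) (h : R -> R) : Prop :=
  increasing_on D h \/ decreasing_on D h.

(* Condition (Z) for z0 defined on [Tz, +oo[ and Lam defined on [TL, +oo[:
   the witnesses Tst and tst must lie in these domains, so that the values of
   the total functions z0 and Lam outside them are irrelevant. *)
Definition condition_Z (R : realType) (d c0 Tz TL : R) (z0 Lam : R -> R)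
  : Prop :=
  [/\ (forall t, Tz <= t -> 0 <= z0 t),
      (forall t, TL <= t -> 0 <= Lam t) &
  exists Tst tst epsst : R,
    [/\ 0 <= Tst /\ Tz <= Tst,
        4 * Tst <= tst /\ TL <= tst,
        0 < epsst,
        (\int[lebesgue_measure]_(x in `[Tst, +oo[)
           (expR (- (d / c0 * z0 x)))%:E = +oo)%E &
        forall eps : R, 0 < eps < epsst ->
          monotone_on `[tst, +oo[
            (fun t => Lam t *
               expR (expR (- (d ^+ 2 / (2 * c0)) - eps) *
                 \int[lebesgue_measure]_(x in `[tst, t + 1])
                   expR (- (d / c0 * z0 x))))]].

(* Main.v *)
(* The power w = u^(l+1)/(l+1), with l = lambda1 >= c1/c0, absorbs the singular
   gradient term and satisfies the linear differential inequality
   w_t - <A, D^2 w> + B . grad w <= u^l f.  Comparison of u itself with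
   C + int_0^t F gives 1 + u <= 2 calF for large times, so that the drift is
   bounded by z(t) = 2^gamma0 bbar(t) calF(t)^gamma0 and the source by
   2^l F calF^l.  On a unit time interval starting at t0, comparison with an
   exponential barrier contracts sup w by the factor 1 - eta, where eta is a
   constant multiple of q(t0 + 1) = exp(-(d/c0) mu bbar calF^gamma0) for a
   suitable mu.  Since (iii) holds for every mu, the boundary data and the
   source contribute at most eps * eta, while the divergence of the integral
   of q makes the product of the contraction factors vanish. *)
Require Import Defs.
From HB Require Import structures.
From mathcomp Require Import all_boot all_order all_algebra.
From mathcomp Require Import all_classical all_reals all_analysis.
From mathcomp Require Import measurable_realfun ring lra.
Set Implicit Arguments.
Unset Strict Implicit.
Unset Printing Implicit Defensive.
Import Order.TTheory GRing.Theory Num.Theory.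
Import numFieldNormedType.Exports.
Local Open Scope classical_set_scope.
Local Open Scope ring_scope.

(** * Derivatives along directions and at maximum points *)

(** The assumed bound on the drift involves [u], so a bound on [u] must come first and cannot rely
    on the drift. It comes from a supersolution that is constant in space: where [u] touches it the
    gradient vanishes, and the terms with [B] and [K] vanish too. This is why the comparison
    principle admits both [sg = 0] and a genuine barrier. The barrier is exponential in a single
    coordinate, and its rate is governed by a bound [rho] on the coordinates of U, not by the
    diameter [d]. The contraction therefore carries the exponent [D / c0] with [D = 2 * rho + 1],
    where (iii) has [d / c0]. The freedom in [mu] repairs this: the ratio [D / d] and the factor
    [2 ^ gamma0] are both put into [mu]. All differential information is extracted at one maximum
    point, by restricting to lines through it. Since [C21] only provides coordinate derivatives,
    derivatives along arbitrary directions have to be built from them. *)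

Lemma derive2_le0_at_max (R : realType) (f df : R -> R) (c r : R) :
  0 < r -> (forall s : R, `|s| < r -> is_derive s 1 f (df s)) ->
  (forall s : R, `|s| < r -> f s <= f 0) -> is_derive (0 : R) 1 df c ->
  df 0 = 0 /\ c <= 0.
Proof.
move=> r0 fd fmax ddf.
have in_r s : s \in `]- r, r[%R -> `|s| < r.
  by rewrite in_itv/= ltr_norml.
have df0 : df 0 = 0.
  have h0 : is_derive (0 : R) 1 f 0.
    apply: (@derive1_at_max _ _ (- r) r).
    - by rewrite lerNl (le_trans _ (ltW r0))// oppr_le0 ltW.
    - by move=> s /in_r /fd [].
    - by rewrite in_itv/= oppr_lt0 r0.
    - by move=> s /in_r; exact: fmax.
  have [_ <-] := fd 0 (ltac:(by rewrite normr0)).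
  by have [_ ->] := h0.
(* If [c > 0], then [df], which vanishes at 0, is positive just to the right of 0, and the mean
   value theorem gives a value of [f] above [f 0]. *)
split => //; rewrite leNgt; apply/negP => c0.
have : (fun h => h^-1 *: (df (h *: 1 + 0) - df 0)) @ 0^' --> c.
  have [dv <-] := ddf.
  exact: dv.
move=> /cvgrPdist_lt /(_ _ c0); rewrite near_withinE.
move=> /nbhs_ballP [e /= e0 he].
pose s := Num.min e r / 2.
have m0 : 0 < Num.min e r by rewrite lt_min e0 r0.
have s0 : 0 < s by rewrite divr_gt0.
have sm : s < Num.min e r by rewrite ltr_pdivrMr// ltr_pMr// ltr1n.
have se : s < e by rewrite (lt_le_trans sm)// ge_min lexx.
have sr : s < r by rewrite (lt_le_trans sm)// ge_min lexx orbT.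
have dfpos (t : R) : 0 < t -> t <= s -> 0 < df t.
  move=> t0 ts; have := he t.
  rewrite /ball /= sub0r normrN gtr0_norm// => /(_ (le_lt_trans ts se)).
  rewrite gt_eqF// => /(_ isT); rewrite df0 subr0 addr0.
  rewrite (_ : t *: 1 = t) ?[X in df X]mulr1; last by rewrite /GRing.scale /= mulr1.
  move=> H; have : 0 < t^-1 *: df t.
    by rewrite -(subKr c (t^-1 *: df t)) subr_gt0 (le_lt_trans (ler_norm _) H).
  by rewrite /GRing.scale /= pmulr_rgt0// invr_gt0.
have inr (t : R) : 0 <= t -> t <= s -> `|t| < r.
  by move=> t0 ts; rewrite ger0_norm// (le_lt_trans ts).
have [||t] := @MVT _ f df 0 s s0.
- move=> t; rewrite in_itv/= => /andP[t0 ts]; apply: fd; apply: inr; exact: ltW.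
- apply: derivable_within_continuous => t; rewrite in_itv/= => /andP[t0 ts].
  by have [] := fd t (inr _ t0 ts).
rewrite in_itv/= subr0 => /andP[t0 ts] eq.
have := fmax s (inr s (ltW s0) (lexx _)).
rewrite -subr_le0 eq leNgt mulr_gt0// dfpos//; exact: ltW.
Qed.

Lemma is_derive_line (R : realType) (V : normedModType R) (f : V -> R)
  (y a : V) (s l : R) :
  is_derive (y + s *: a) a f l <-> is_derive s 1 (fun s => f (y + s *: a)) l.
Proof.
have E : (fun h => h^-1 *: ((f \o shift (y + s *: a)) (h *: a) - f (y + s *: a)))
  = (fun h => h^-1 *: (((fun s => f (y + s *: a)) \o shift s) (h *: (1 : R)) -
       (fun s => f (y + s *: a)) s)).
  apply/funext => h /=; congr (_ *: (f _ - _)).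
  have -> : h *: (1 : R) = h by rewrite -[RHS]mulr1.
  by rewrite scalerDl addrCA.
split => -[d1 d2]; constructor.
- by move: d1; rewrite /derivable E.
- by rewrite -d2 /derive E.
- by rewrite /derivable E.
- by rewrite -d2 /derive E.
Qed.

Lemma is_derive_dirZ (R : realType) (V : normedModType R) (f : V -> R)
  (y a : V) (c l : R) :
  is_derive y a f l -> is_derive y (c *: a) f (c * l).
Proof.
move=> h.
have h1 : is_derive (c * 0 : R) 1 (fun s => f (y + s *: a)) l.
  by apply: (is_derive_line f y a (c * 0) l).1; rewrite mulr0 scale0r addr0.
have h2 : is_derive (0 : R) 1 (fun s => f (y + (s *: (c *: a)))) (c * l).
  have h3 : is_derive (0 : R) 1 (fun s : R => c * s) c.
    have -> : (fun s : R => c * s) = c \*: (id : R -> R) by [].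
    by apply: is_derive_eq; rewrite /GRing.scale /= mulr1.
  have := @is_derive1_comp _ (fun s => f (y + s *: a)) (fun s => c * s) 0 _ _ h1 h3.
  rewrite mulrC => h4.
  rewrite (_ : (fun _ => _) = (fun s => f (y + s *: a)) \o (fun s => c * s))//.
  by apply/funext => s /=; rewrite scalerA mulrC.
move: ((is_derive_line f y (c *: a) 0 (c * l)).2 h2).
by rewrite scale0r addr0.
Qed.

(** The increment along [h *: (a + b)] splits at [x + h *: b]. The mean value theorem turns the part
    along [a] into [h] times a value of [Da] at a point tending to [x], and continuity of [Da] gives
    its limit. *)
Lemma is_derive_dirD (R : realType) (V : normedModType R) (f Da : V -> R)
  (x a b : V) (l : R) :
  (\forall y \near x, is_derive y a f (Da y)) -> {for x, continuous Da} ->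
  is_derive x b f l -> is_derive x (a + b) f (Da x + l).
Proof.
move=> fa ca [fb1 fb2].
suff cv : (fun h => h^-1 *: ((f \o shift x) (h *: (a + b)) - f x)) @ 0^' --> Da x + l.
  split; first by apply/cvg_ex; exists (Da x + l).
  exact: cvg_lim.
have -> : (fun h => h^-1 *: ((f \o shift x) (h *: (a + b)) - f x)) =
  (fun h => h^-1 *: (f (x + h *: b + h *: a) - f (x + h *: b))) \+
  (fun h => h^-1 *: ((f \o shift x) (h *: b) - f x)).
  apply/funext => h /=; rewrite -scalerDr; congr (_ *: _).
  rewrite [h *: b + x]addrC addrA subrK scalerDr; congr (f _ - _).
  by rewrite addrC addrA addrAC.
apply: cvgD; last first.
  by have : cvg ((fun h => h^-1 *: ((f \o shift x) (h *: b) - f x)) @ 0^') by []; rewrite -fb2.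
apply/cvgrPdist_lt => e e0; rewrite near_withinE.
have : \forall y \near x, is_derive y a f (Da y) /\ `|Da x - Da y| < e.
  apply: filterI => //.
  by move: ca => /cvgrPdist_lt /(_ _ e0).
move=> /nbhs_ballP [r /= r0 hr].
(* Dividing the radius by this number keeps the whole segment from [x + h *: b] to
   [x + h *: b + h *: a] inside the ball; the 1 only keeps the divisor positive. *)
have M0 : 0 < `|a| + `|b| + 1 by rewrite ltr_wpDl// addr_ge0.
apply/nbhs_ballP; exists (r / (`|a| + `|b| + 1)) => /=; first by rewrite divr_gt0.
move=> h; rewrite /ball/= sub0r normrN ltr_pdivlMr// => hh h0.
have inb (s : R) : `|s| <= 1 -> ball x r (x + h *: b + s *: (h *: a)).
  move=> s1; rewrite -ball_normE /ball_/= -addrA opprD addrA subrr sub0r normrN.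
  apply: le_lt_trans hh; apply: le_trans (ler_normD _ _) _.
  rewrite !normrZ mulrA [`|s| * _]mulrC -!mulrA -mulrDr ler_wpM2l//.
  rewrite addrC ler_wpDr// lerD2r.
  by rewrite ler_piMl.
have dz (s : R) : `|s| <= 1 -> is_derive s 1 (fun s => f (x + h *: b + s *: (h *: a)))
   (h * Da (x + h *: b + s *: (h *: a))).
  move=> s1; apply: (is_derive_line f (x + h *: b) (h *: a) s _).1; apply: is_derive_dirZ.
  by have [] := hr _ (inb _ s1).
have i01 (s : R) : 0 <= s -> s <= 1 -> `|s| <= 1 by move=> s0 s1; rewrite ger0_norm.
have [||t] := @MVT _ (fun s => f (x + h *: b + s *: (h *: a)))
  (fun s => h * Da (x + h *: b + s *: (h *: a))) 0 1 ltr01.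
- by move=> s; rewrite in_itv/= => /andP[/ltW s0 /ltW s1]; apply/dz/i01.
- apply: derivable_within_continuous => t; rewrite in_itv/= => /andP[t0 t1].
  by have [] := dz t (i01 _ t0 t1).
rewrite in_itv/= scale1r scale0r addr0 subr0 mulr1 => /andP[t0 t1] ->.
rewrite /GRing.scale/= mulrA mulVf// mul1r.
by have [] := hr _ (inb _ (i01 _ (ltW t0) (ltW t1))).
Qed.

(** The direction is assembled one coordinate at a time with [is_derive_dirD]. Applied to [u] and
    again to its partial derivatives, this allows second derivative tests along every line. *)
Lemma is_derive_partials (R : realType) (n : nat) (U : set 'rV[R]_n)
  (f : 'rV[R]_n -> R) (D : 'I_n -> 'rV[R]_n -> R) :
  open U ->
  (forall i y, U y -> is_derive y (delta_mx 0 i) f (D i y)) ->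
  (forall i y, U y -> {for y, continuous (D i)}) ->
  forall x v, U x -> is_derive x v f (\sum_(i < n) v 0 i * D i x).
Proof.
move=> Uo fD cD x v Ux; rewrite [X in is_derive _ X]row_sum_delta.
elim: (index_enum _) => [|i s IHs].
  by rewrite !big_nil; exact: is_derive0.
rewrite !big_cons.
apply: (@is_derive_dirD _ _ f (fun y => v 0 i * D i y)) => //.
  have : \forall y \near x, U y by exact: open_nbhs_nbhs.
  by apply: filterS => y Uy; apply: is_derive_dirZ; exact: fD.
by apply: continuousM; [exact: cst_continuous | exact: cD].
Qed.

(** * Positive semidefinite matrices *)

Lemma quad_delta (R : realType) (n : nat) (A : 'M[R]_n) (i j : 'I_n) :
  ((delta_mx 0 i : 'rV[R]_n) *m A *m (delta_mx 0 j : 'rV[R]_n)^T) 0 0 = A i j.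
Proof. by rewrite -rowE trmx_delta -colE !mxE. Qed.

Lemma quad_sym (R : realType) (n : nat) (A : 'M[R]_n) (v w : 'rV[R]_n) :
  A^T = A -> (v *m A *m w^T) 0 0 = (w *m A *m v^T) 0 0.
Proof.
move=> As; have -> : w *m A *m v^T = (v *m A *m w^T)^T.
  by rewrite !trmx_mul trmxK As mulmxA.
by rewrite [RHS]mxE.
Qed.

Lemma quadD (R : realType) (n : nat) (A : 'M[R]_n) (v w : 'rV[R]_n) (s : R) :
  A^T = A -> ((v + s *: w) *m A *m (v + s *: w)^T) 0 0 =
   (v *m A *m v^T) 0 0 + 2 * s * (w *m A *m v^T) 0 0
     + s ^+ 2 * (w *m A *m w^T) 0 0.
Proof.
move=> As; rewrite linearD linearZ /= !mulmxDl !mulmxDr -!scalemxAl -!scalemxAr.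
move: (quad_sym v w As).
rewrite !mxE => ->; ring.
Qed.

Lemma psd_diag0 (R : realType) (n : nat) (A : 'M[R]_n) (i j : 'I_n) :
  A^T = A -> (forall v : 'rV[R]_n, 0 <= (v *m A *m v^T) 0 0) ->
  A i i = 0 -> A i j = 0.
Proof.
move=> As Apos Aii; apply/eqP/negPn/negP => Aij.
(* As [A i i = 0], the form is affine in the coefficient of [delta_mx 0 i]; this coefficient makes
   its value -1. *)
have := Apos (delta_mx 0 j + (- (A j j + 1) / (2 * A i j)) *: delta_mx 0 i).
rewrite quadD// !quad_delta Aii mulr0 addr0.
rewrite (_ : A j j + 2 * _ * _ = -1); last by field.
by rewrite lerNr oppr0 ler10.
Qed.

(* One step of symmetric Gaussian elimination: subtracting the rank-one matrix
   built on row [i] keeps [A] positive semidefinite and clears row [i]. *)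
Lemma trace_psd_nsd (R : realType) (n : nat) (A N : 'M[R]_n) :
  A^T = A -> (forall v : 'rV[R]_n, 0 <= (v *m A *m v^T) 0 0) ->
  (forall v : 'rV[R]_n, (v *m N *m v^T) 0 0 <= 0) -> \tr (A *m N) <= 0.
Proof.
move=> As Apos Nneg.
(* Here [k] counts the rows that may still be non-zero: those of index below [n - k] have been
   cleared. *)
suff H k : (k <= n)%N -> forall A : 'M[R]_n,
    A^T = A -> (forall v : 'rV[R]_n, 0 <= (v *m A *m v^T) 0 0) ->
    (forall i j : 'I_n, (i < n - k)%N -> A i j = 0) -> \tr (A *m N) <= 0.
  by apply: (H n) => // i j; rewrite subnn.
elim: k => [_ {As Apos} {}A _ _ A0|k IHk kn {As Apos} {}A As Apos A0].
  have -> : A = 0 by apply/matrixP => i j; rewrite A0 ?subn0// mxE.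
  by rewrite mul0mx mxtrace0.
have ltn : (n - k.+1 < n)%N by rewrite ltn_subrL /= (leq_trans _ kn).
pose i := Ordinal ltn.
have lti (j : 'I_n) : (j < n - k)%N -> (j < n - k.+1)%N \/ j = i.
  rewrite subnS; case: (n - k)%N (subnS n k) => [//|m] nk /=.
  rewrite ltnS leq_eqVlt => /orP[/eqP jm|->]; last by left.
  by right; apply: val_inj; rewrite /= nk jm.
have [Aii|Aii] := eqVneq (A i i) 0.
  apply: IHk => //; first exact: ltnW.
  by move=> j l /lti [/A0 //|->]; exact: psd_diag0.
pose r := row i A.
pose A' := A - (A i i)^-1 *: (r^T *m r).
have rE : r = delta_mx 0 i *m A by rewrite /r rowE.
have ri (v : 'rV_n) : v *m r^T = (r *m v^T)^T by rewrite trmx_mul trmxK.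
have A's : A'^T = A'.
  by rewrite /A' linearB linearZ /= trmx_mul trmxK As.
have Aiip : 0 <= A i i by rewrite -(quad_delta A i i).
have quadA' (v : 'rV[R]_n) : (v *m A' *m v^T) 0 0 =
   (v *m A *m v^T) 0 0 - (A i i)^-1 * ((r *m v^T) 0 0) ^+ 2.
  have <- : (v *m r^T *m (r *m v^T)) 0 0 = ((r *m v^T) 0 0) ^+ 2.
    by rewrite ri mxE big_ord1 [_^T _ _]mxE expr2.
  rewrite /A' mulmxBr mulmxBl -scalemxAr -scalemxAl !mulmxA.
  by rewrite [LHS]mxE; congr (_ + _); rewrite mxE; congr (- _); rewrite mxE.
have -> : A *m N = A' *m N + (A i i)^-1 *: (r^T *m r *m N).
  by rewrite /A' mulmxBl -scalemxAl subrK.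
rewrite mxtraceD mxtraceZ -mulmxA [\tr (r^T *m _)]mxtrace_mulC trace_mx11.
rewrite -[leRHS]addr0; apply: lerD; last first.
  by rewrite mulr_ge0_le0// invr_ge0.
apply: IHk => //; first exact: ltnW.
- move=> v; rewrite quadA'.
  set c := (r *m v^T) 0 0.
  (* This point minimizes the form of [A] on the line through [v] along [delta_mx 0 i], and the
     minimum is the value of the form of [A'] at [v]. *)
  have := Apos (v + (- c / A i i) *: delta_mx 0 i).
  rewrite quadD// quad_delta -rE -/c.
  congr (_ <= _); field; exact: Aii.
- move=> j l jk; rewrite /A' !mxE big_ord1 !mxE.
  have [/A0 Aj|->] := lti _ jk; last by field.
  have -> : A i j = 0 by rewrite -As mxE Aj.
  by rewrite Aj mul0r mulr0 subr0.
Qed.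

(** * Necessary conditions at a touching point *)

Lemma is_derive_powR_comp (R : realType) (h : R -> R) (s l a : R) :
  0 < h s -> is_derive s 1 h l ->
  is_derive s 1 (fun s => h s `^ a) (a * h s `^ (a - 1) * l).
Proof.
move=> hs hl.
have := @is_derive1_comp _ (@powR R ^~ a) h s _ _ (is_derive1_powR a hs) hl.
by rewrite mulrC [l * _]mulrC.
Qed.

Lemma is_derive_expR_affine (R : realType) (a b s : R) :
  is_derive s 1 (fun s => expR (a + s * b)) (b * expR (a + s * b)).
Proof.
have h : is_derive s 1 (fun s : R => a + s * b) b.
  have -> : (fun s : R => a + s * b) = cst a + b \*: (id : R -> R).
    by apply/funext => z; rewrite /= mulrC.
  by apply: is_derive_eq; rewrite /GRing.scale /= mulr1 add0r.
have := @is_derive1_comp _ expR (fun s => a + s * b) s _ _ (is_derive_expR _) h.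
by rewrite mulrC.
Qed.

Lemma touching_space (R : realType) (n : nat) (U : set 'rV[R]_n)
  (f : 'rV[R]_n -> R) (D : 'I_n -> 'rV[R]_n -> R)
  (DD : 'I_n -> 'I_n -> 'rV[R]_n -> R) (lam k c sg : R) (i0 : 'I_n)
  (x v : 'rV[R]_n) :
  open U -> 0 <= lam -> (forall y, U y -> 0 < f y) ->
  (forall i y, U y -> is_derive y (delta_mx 0 i) f (D i y)) ->
  (forall i y, U y -> {for y, continuous (D i)}) ->
  (forall i j y, U y -> is_derive y (delta_mx 0 i) (D j) (DD i j y)) ->
  (forall i j y, U y -> {for y, continuous (DD i j)}) ->
  U x ->
  (forall y, U y ->
    f y `^ (lam + 1) / (lam + 1) + sg * expR (k * y 0 i0 + c) <=
    f x `^ (lam + 1) / (lam + 1) + sg * expR (k * x 0 i0 + c)) ->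
  let E := sg * expR (k * x 0 i0 + c) in
  f x `^ lam * (\sum_(i < n) v 0 i * D i x) + E * (k * v 0 i0) = 0 /\
  f x `^ lam * (\sum_(j < n) v 0 j * \sum_(i < n) v 0 i * DD i j x)
  + lam * (f x `^ lam / f x) * (\sum_(i < n) v 0 i * D i x) ^+ 2
  + E * (k * v 0 i0) ^+ 2 <= 0.
Proof.
move=> Uo lam0 fpos fD cD DD1 cDD Ux fmax E.
pose Dv y := \sum_(i < n) v 0 i * D i y.
have fDv y : U y -> is_derive y v f (Dv y).
  exact: (@is_derive_partials _ _ U f D).
have DDv y : U y ->
    is_derive y v Dv (\sum_(j < n) v 0 j * \sum_(i < n) v 0 i * DD i j y).
  move=> Uy.
  have h j : is_derive y v (D j) (\sum_(i < n) v 0 i * DD i j y).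
    apply: (@is_derive_partials _ _ U (D j) (fun i => DD i j)) => //.
    by move=> i z Uz; exact: cDD.
  have -> : Dv = \sum_(j < n) (v 0 j \*: D j).
    by apply/funext => z; rewrite fct_sumE.
  apply: is_derive_sum => j; exact: is_deriveZ.
have [r r0 hr] : exists2 r, 0 < r & forall s : R, `|s| < r -> U (x + s *: v).
  have /nbhs_ballP [r /= r0 hr] : nbhs x U by exact: open_nbhs_nbhs.
  exists (r / (`|v| + 1)); first by rewrite divr_gt0// ltr_wpDl.
  move=> s; rewrite ltr_pdivlMr ?ltr_wpDl// => sr; apply: hr.
  rewrite -ball_normE /ball_/= opprD addrA subrr sub0r normrN normrZ.
  by apply: le_lt_trans sr; rewrite ler_wpM2l// lerDl.
have lam1 : lam + 1 != 0 by rewrite gt_eqF// ltr_wpDl.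
pose h s := f (x + s *: v).
have hd (s : R) : `|s| < r -> is_derive s 1 h (Dv (x + s *: v)).
  by move=> sr; apply: (is_derive_line f x v s _).1; apply/fDv/hr.
have hp (s : R) : `|s| < r -> 0 < h s by move=> sr; apply/fpos/hr.
pose w s := h s `^ (lam + 1) / (lam + 1)
   + sg * expR ((k * x 0 i0 + c) + s * (k * v 0 i0)).
pose dw s := h s `^ lam * Dv (x + s *: v)
   + sg * ((k * v 0 i0) * expR ((k * x 0 i0 + c) + s * (k * v 0 i0))).
have wE s : w s = f (x + s *: v) `^ (lam + 1) / (lam + 1)
   + sg * expR (k * (x + s *: v) 0 i0 + c).
  by rewrite /w !mxE; congr (_ + _ * expR _); ring.
have x0 : x + 0 *: v = x by rewrite scale0r addr0.
have r00 : `|0 : R| < r by rewrite normr0.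
pose ddw0 := h 0 `^ lam * (\sum_(j < n) v 0 j * \sum_(i < n) v 0 i * DD i j x)
   + Dv x * (lam * h 0 `^ (lam - 1) * Dv x) + sg * ((k * v 0 i0) *
     ((k * v 0 i0) * expR ((k * x 0 i0 + c) + 0 * (k * v 0 i0)))).
have wd (s : R) : `|s| < r -> is_derive s 1 w (dw s).
  move=> sr.
  have h1 := is_derive_powR_comp (lam + 1) (hp s sr) (hd s sr).
  have h2 := is_derive_expR_affine (k * x 0 i0 + c) (k * v 0 i0) s.
  have -> : w = (lam + 1)^-1 \*: (fun s => h s `^ (lam + 1)) +
     sg \*: (fun s => expR (k * x 0 i0 + c + s * (k * v 0 i0))).
    by apply/funext => z; rewrite /w mulrC.
  apply: is_derive_eq; rewrite /dw /GRing.scale/= addrK; congr (_ + _).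
  by rewrite !mulrA mulVf// mul1r.
have wmax (s : R) : `|s| < r -> w s <= w 0.
  by move=> sr; rewrite !wE x0; apply/fmax/hr.
have dwd : is_derive (0 : R) 1 dw ddw0.
  have h1 := is_derive_powR_comp lam (hp 0 r00) (hd 0 r00).
  have h2 := is_derive_expR_affine (k * x 0 i0 + c) (k * v 0 i0) 0.
  have h3 : is_derive (0 : R) 1 (fun s => Dv (x + s *: v))
      (\sum_(j < n) v 0 j * \sum_(i < n) v 0 i * DD i j x).
    by apply: (is_derive_line Dv x v 0 _).1; rewrite x0; exact: DDv.
  have -> : dw = (fun s => h s `^ lam) * (fun s => Dv (x + s *: v)) +
     sg \*: ((k * v 0 i0) \*: (fun s => expR (k * x 0 i0 + c + s * (k * v 0 i0)))).
    by [].
  by apply: is_derive_eq; rewrite /GRing.scale/= x0.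
have [] := derive2_le0_at_max r0 wd wmax dwd.
rewrite /dw /ddw0 /h x0 mul0r addr0 => h1 h2; split.
  by rewrite -[RHS]h1; congr (_ + _); rewrite /E; ring.
move: h2; congr (_ <= _); rewrite powRB ?powRr1 ?(ltW (fpos _ Ux))//; last first.
  by rewrite (gt_eqF (fpos _ Ux)) implybT.
by rewrite /E -/(Dv x); ring.
Qed.

Lemma dotvE (R : realType) (n : nat) (v w : 'rV[R]_n) :
  dotv v w = (v *m w^T) 0 0.
Proof. by rewrite /dotv mxE; apply: eq_bigr => i _; rewrite mxE. Qed.

Lemma dotvC (R : realType) (n : nat) (v w : 'rV[R]_n) : dotv v w = dotv w v.
Proof. by apply: eq_bigr => i _; rewrite mulrC. Qed.

Lemma dotv_delta (R : realType) (n : nat) (i : 'I_n) (v : 'rV[R]_n) :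
  dotv (delta_mx 0 i) v = v 0 i.
Proof.
rewrite /dotv (bigD1 i)//= mxE !eqxx mul1r big1 ?addr0// => j ji.
by rewrite mxE (negbTE ji) mul0r.
Qed.

Lemma dotvv_ge0 (R : realType) (n : nat) (v : 'rV[R]_n) : 0 <= dotv v v.
Proof. by apply: sumr_ge0 => i _; rewrite -expr2 sqr_ge0. Qed.

Lemma enorm_sqr (R : realType) (n : nat) (v : 'rV[R]_n) :
  enorm v ^+ 2 = dotv v v.
Proof. by rewrite sqr_sqrtr// dotvv_ge0. Qed.

Lemma ler_coord_enorm (R : realType) (n : nat) (v : 'rV[R]_n) (i : 'I_n) :
  `|v 0 i| <= enorm v.
Proof.
rewrite -sqrtr_sqr ler_sqrt ?dotvv_ge0// /dotv (bigD1 i)//= expr2 lerDl.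
by apply: sumr_ge0 => j _; rewrite -expr2 sqr_ge0.
Qed.

Lemma dotv_mulmxv (R : realType) (n : nat) (M : 'M[R]_n) (v w : 'rV[R]_n) :
  dotv v (mulmxv M w) = (v *m M *m w^T) 0 0.
Proof. by rewrite dotvE /mulmxv trmx_mul trmxK mulmxA. Qed.

(** The quadratic forms in the hypothesis add up to that of one matrix, [p *: H] plus two rank-one
    terms. Its trace against [A] is non-positive, the rank-one terms contribute values of the form
    of [A], and [A i0 i0 >= c0] by ellipticity. *)
Lemma touching_diffusion (R : realType) (n : nat) (A H : 'M[R]_n)
  (G : 'rV[R]_n) (i0 : 'I_n) (c0 p q e : R) :
  A^T = A -> 0 <= c0 -> 0 <= e ->
  (forall xi, c0 * enorm xi ^+ 2 <= dotv xi (mulmxv A xi)) ->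
  (forall v : 'rV[R]_n,
    p * (\sum_(j < n) v 0 j * \sum_(i < n) v 0 i * H i j)
      + q * (\sum_(i < n) v 0 i * G 0 i) ^+ 2 + e * v 0 i0 ^+ 2 <= 0) ->
  p * frob A H + q * dotv G (mulmxv A G) + e * c0 <= 0.
Proof.
move=> As c0_ge0 e0 ell hv.
pose d : 'rV[R]_n := delta_mx 0 i0.
pose N := p *: H + q *: (G^T *m G) + e *: (d^T *m d).
have sq (w v : 'rV[R]_n) : (v *m (w^T *m w) *m v^T) 0 0 = dotv v w ^+ 2.
  rewrite mulmxA -mulmxA mxE big_ord1 -!dotvE [dotv w v]dotvC expr2.
  by [].
have : \tr (A *m N) <= 0.
  apply: trace_psd_nsd => //.
    move=> v; rewrite -dotv_mulmxv; apply: le_trans (ell v).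
    by rewrite mulr_ge0// sqr_ge0.
  move=> v; apply: le_trans (hv v); rewrite le_eqVlt; apply/orP; left; apply/eqP.
  rewrite /N !mulmxDr !mulmxDl -!scalemxAr -!scalemxAl.
  have addE (X Y : 'M[R]_1) : (X + Y) 0 0 = X 0 0 + Y 0 0 by rewrite mxE.
  have scaleE (s : R) (X : 'M[R]_1) : (s *: X) 0 0 = s * X 0 0 by rewrite mxE.
  rewrite !addE !scaleE !sq [dotv v d]dotvC dotv_delta.
  congr (p * _ + _ + _); rewrite mxE; apply: eq_bigr => j _.
  by rewrite mxE [v^T _ _]mxE mulrC.
have trq (w : 'rV[R]_n) : \tr (A *m (w^T *m w)) = dotv w (mulmxv A w).
  by rewrite mulmxA mxtrace_mulC trace_mx11 mulmxA dotv_mulmxv.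
rewrite /N !mulmxDr -!scalemxAr !mxtraceD !mxtraceZ !trq.
apply: le_trans; rewrite /frob As lerD2l ler_wpM2l//.
by have := ell d; rewrite enorm_sqr dotv_delta mxE !eqxx mulr1.
Qed.

(** In use, [P] is [u ^ lam], [U] is the value of [u], and [E] is the barrier term. The first-order
    relation rewrites the drift as [- E * k * b_i0], which is dominated by the diffusion
    [E * c0 * k ^ 2] of the barrier. The Hessian of the power yields [lam * P / U] times the form of
    [A] at the gradient, at least [lam * c0 * P / U] times its squared length. The term with [K] is
    at least [- c1 * P / U] times the same square, since the derivative of the logarithm is
    [U^-1]. *)
Lemma touching_source (R : realType) (n : nat) (A K H : 'M[R]_n)
  (b G : 'rV[R]_n) (i0 : 'I_n) (c0 c1 lam P U E k th z ut fv : R) :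
  A^T = A -> 0 < c0 -> 0 <= lam -> 0 < P -> 0 < U -> 0 <= E -> 0 <= k ->
  (forall xi, c0 * enorm xi ^+ 2 <= dotv xi (mulmxv A xi)) ->
  (forall xi, - c1 * enorm xi ^+ 2 <= dotv xi (mulmxv K xi)) ->
  (forall v : 'rV[R]_n, P * (\sum_(i < n) v 0 i * G 0 i) + E * (k * v 0 i0) = 0) ->
  (forall v : 'rV[R]_n,
    P * (\sum_(j < n) v 0 j * \sum_(i < n) v 0 i * H i j)
      + lam * (P / U) * (\sum_(i < n) v 0 i * G 0 i) ^+ 2
      + E * (k * v 0 i0) ^+ 2 <= 0) ->
  E = 0 \/ [/\ c1 <= lam * c0, enorm b <= z & th + k * z <= c0 * k ^+ 2] ->
  ut - frob A H + dotv b G + U^-1 * dotv (mulmxv K G) G = fv ->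
  P * ut + E * th <= P * fv.
Proof.
move=> As c00 lam0 P0 U0 E0 k0 ellA ellK h1 h2 hE <-.
have := @touching_diffusion _ _ A H G i0 c0 P (lam * (P / U)) (E * k ^+ 2)
  As (ltW c00) (mulr_ge0 E0 (sqr_ge0 _)) ellA.
have -> : P * (ut - frob A H + dotv b G + U^-1 * dotv (mulmxv K G) G) =
   P * ut - P * frob A H + P * dotv b G + P / U * dotv G (mulmxv K G).
  by rewrite [dotv G _]dotvC; ring.
have hb : P * dotv b G = - (E * (k * b 0 i0)).
  by apply/eqP; rewrite eq_sym -subr_eq0 -opprD oppr_eq0 addrC h1.
rewrite hb.
have PU0 : 0 < P / U by rewrite divr_gt0.
have hq (v : 'rV[R]_n) :
    P * (\sum_(j < n) v 0 j * \sum_(i < n) v 0 i * H i j)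
      + lam * (P / U) * (\sum_(i < n) v 0 i * G 0 i) ^+ 2
      + E * k ^+ 2 * v 0 i0 ^+ 2 <= 0.
  by have := h2 v; rewrite exprMn [E * _]mulrA.
move=> /(_ hq); move: (ellA G) (ellK G); rewrite enorm_sqr.
set AGG := dotv G (mulmxv A G); set KGG := dotv G (mulmxv K G).
set GG := dotv G G => hA hK hd.
have GG0 : 0 <= GG by exact: dotvv_ge0.
(* With [E = 0], the first-order relation in the direction [G] itself forces [G = 0], and every
   gradient term disappears. *)
case: hE => [EE|[hc hbz hk]].
  have GG0' : GG = 0.
    have := h1 G; rewrite EE mul0r addr0 => /eqP.
    by rewrite mulf_eq0 (gt_eqF P0)/= => /eqP.
  move: hA hK hd; rewrite GG0' !mulr0 EE !mul0r !addr0 oppr0 addr0 => hA hK hd.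
  have := mulr_ge0 (mulr_ge0 lam0 (ltW PU0)) hA.
  have := mulr_ge0 (ltW PU0) hK.
  lra.
have bz : b 0 i0 <= z.
  by apply: le_trans hbz; apply: le_trans (ler_norm _) (ler_coord_enorm _ _).
have s1 : E * (k * b 0 i0) <= E * (c0 * k ^+ 2 - th).
  rewrite ler_wpM2l// lerBrDr addrC; apply: le_trans hk.
  by rewrite lerD2l ler_wpM2l.
have s2 : 0 <= P / U * (lam * AGG + KGG).
  apply: mulr_ge0; first exact: ltW.
  have : lam * (c0 * GG) <= lam * AGG by rewrite ler_wpM2l.
  have : c1 * GG <= lam * c0 * GG by rewrite ler_wpM2r.
  move: hK; lra.
move: s1 s2 hd; set x1 := P / U; set x2 := P * frob A H.
rewrite [E * (c0 * _ - _)]mulrBr mulrDr -[E * k ^+ 2 * c0]mulrA [k ^+ 2 * c0]mulrC.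
rewrite [x1 * (lam * _)]mulrCA -[lam * x1 * _]mulrA.
lra.
Qed.

(** Only earlier times are compared, because the maximum over a cylinder may be attained at its
    final time. *)
Lemma derive_ge0_left_max (R : realType) (g : R -> R) (a t d : R) :
  a < t -> is_derive t 1 g d -> (forall s, a <= s <= t -> g s <= g t) -> 0 <= d.
Proof.
move=> at' [gd <-] gmax; rewrite leNgt; apply/negP => d0.
have : (fun h => h^-1 *: (g (h *: 1 + t) - g t)) @ 0^' --> 'D_1 g t by exact: gd.
have Nd0 : 0 < - 'D_1 g t by rewrite oppr_gt0.
move=> /cvgrPdist_lt /(_ _ Nd0); rewrite near_withinE.
move=> /nbhs_ballP [e /= e0 he].
pose s := Num.min e (t - a) / 2.
have m0 : 0 < Num.min e (t - a) by rewrite lt_min e0 subr_gt0.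
have s0 : 0 < s by rewrite divr_gt0.
have sm : s < Num.min e (t - a) by rewrite ltr_pdivrMr// ltr_pMr// ltr1n.
have se : s < e by rewrite (lt_le_trans sm)// ge_min lexx.
have sr : s < t - a by rewrite (lt_le_trans sm)// ge_min lexx orbT.
have := he (- s); rewrite /ball /= sub0r opprK gtr0_norm// => /(_ se).
rewrite oppr_eq0 gt_eqF// => /(_ isT).
have -> : - s *: (1 : R) = - s by rewrite -[RHS]mulr1.
rewrite ltNge => /negP; apply.
rewrite -normrN; apply: le_trans (ler_norm _).
set D := 'D_1 g t in d0 *; set y := (- s)^-1 *: _.
suff y0 : 0 <= y by lra.
rewrite /y /GRing.scale/= invrN mulNr oppr_ge0 pmulr_rle0 ?invr_gt0// subr_le0.
apply: gmax; lra.
Qed.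

(** * Comparison principle *)

(** With the absolute value the power is continuous on the whole line, so it composes with [u] and
    [calF], which are known to be non-negative only on part of their domains. *)
Lemma continuous_normr_powR (R : realType) (p : R) : 0 < p ->
  continuous (fun s : R => `|s| `^ p).
Proof.
move=> p0 s; have [->|s0] := eqVneq s 0.
  rewrite /continuous_at normr0 powR0 ?gt_eqF//; apply/cvgrPdist_lt => e e0.
  have e1 : 0 < e `^ p^-1 by exact: powR_gt0.
  apply/nbhs_ballP; exists (e `^ p^-1) => //= t.
  rewrite /ball/= sub0r normrN => ht.
  rewrite sub0r normrN ger0_norm ?powR_ge0//.
  have := @gt0_ltr_powR _ p p0 `|t| (e `^ p^-1).
  rewrite !nnegrE normr_ge0 (ltW e1) => /(_ isT isT ht).
  by rewrite -powRrM mulVf ?gt_eqF// powRr1// ltW.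
apply: (@continuous_comp _ _ _ (fun s : R => `|s|) (@powR R ^~ p)).
  exact: norm_continuous.
apply: differentiable_continuous; apply/derivable1_diffP.
by apply: derivable_powR; rewrite in_itv/= andbT normr_gt0.
Qed.

Lemma bounded_closure (R : realType) (n : nat) (U : set 'rV[R]_n) :
  bounded_set U -> bounded_set (closure U).
Proof.
move=> [M [Mr hM]]; exists M; split => // N MN x.
have : closed [set y : 'rV[R]_n | `|y| <= N].
  apply: (@closed_comp _ _ (fun y : 'rV[R]_n => `|y|) [set z : R | z <= N]).
    by move=> y _; exact: norm_continuous.
  exact: closed_le.
move=> /closure_id => cN xU; rewrite -/([set y : 'rV[R]_n | `|y| <= N] x) cN.
by move: x xU; apply: closure_subset => y Uy; exact: hM.
Qed.

Lemma compact_cylinder (R : realType) (n : nat) (U : set 'rV[R]_n) (a b : R) :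
  bounded_set U -> compact (closure U `*` `[a, b]).
Proof.
move=> Ub; apply: compact_setX; last exact: segment_compact.
apply: bounded_closed_compact; first exact: bounded_closure.
exact: closed_closure.
Qed.

Lemma continuous_slice (R : realType) (n : nat) (V : set 'rV[R]_n) (I : set R)
  (u : 'rV[R]_n -> R -> R) (t : R) :
  continuous_on (V `*` I) u -> I t -> {within V, continuous (u ^~ t)}.
Proof.
move=> /subspace_continuousP hu It; apply/subspace_continuousP => x Vx.
have h := hu (x, t) (conj Vx It).
move=> Q /h hQ.
change (nbhs (x, t) (fun p => (V `*` I) p -> Q (u p.1 p.2))) in hQ.
change (nbhs x (fun y => V y -> Q (u y t))).
have ct : (fun y : 'rV[R]_n => (y, t)) @ nbhs x --> nbhs (x, t).
    have h1 : (fun y : 'rV[R]_n => y) @ nbhs x --> x by exact: cvg_id.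
    have h2 : (fun y : 'rV[R]_n => t) @ nbhs x --> t by exact: cvg_cst.
    exact: (cvg_pair h1 h2).
  have h' : nbhs x (fun y => (V `*` I) (y, t) -> Q (u y t)) by exact: ct _ hQ.
by apply: (filterS _ h') => y hy Vy; exact: hy.
Qed.

Lemma continuous_slice_open (R : realType) (n : nat) (V : set 'rV[R]_n)
  (I : set R) (u : 'rV[R]_n -> R -> R) (x : 'rV[R]_n) (t : R) :
  open V -> continuous_on (V `*` I) u -> V x -> I t ->
  {for x, continuous (u ^~ t)}.
Proof.
move=> Vo hu Vx It; have := continuous_slice hu It.
by rewrite continuous_open_subspace// => /(_ x (mem_set Vx)).
Qed.

Lemma closure_ge0 (R : realType) (n : nat) (V : set 'rV[R]_n)
  (f : 'rV[R]_n -> R) (x : 'rV[R]_n) :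
  {within closure V, continuous f} -> (forall y, V y -> 0 <= f y) ->
  closure V x -> 0 <= f x.
Proof.
move=> /subspace_continuousP hf f0 Vx; rewrite leNgt; apply/negP => fx0.
have /cvgrPdist_lt /(_ (- f x)) := hf x Vx.
rewrite oppr_gt0 => /(_ fx0); rewrite near_withinE => hn.
have [y [Vy hy]] := Vx _ hn.
have hyx : `|f x - f y| < - f x by exact: hy (subset_closure Vy).
have := f0 y Vy; rewrite distrC in hyx.
by have := le_lt_trans (ler_norm _) hyx; lra.
Qed.

Lemma solution_ge0 (R : realType) (n : nat) (U : set 'rV[R]_n)
  (u : 'rV[R]_n -> R -> R) :
  continuous_on (closure U `*` `[0, +oo[) u ->
  (forall x t, U x -> 0 < t -> 0 < u x t) ->
  forall x t, closure U x -> 0 < t -> 0 <= u x t.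
Proof.
move=> uc upos x t Ux t0; apply: (@closure_ge0 _ _ U (u ^~ t)) => //.
  by apply: continuous_slice uc _; rewrite /= in_itv/= andbT ltW.
by move=> y Uy; rewrite ltW// upos.
Qed.

Lemma solution_cylinder_bound (R : realType) (n : nat) (U : set 'rV[R]_n)
  (u : 'rV[R]_n -> R -> R) (t : R) :
  U !=set0 -> bounded_set U ->
  continuous_on (closure U `*` `[0, +oo[) u -> 0 <= t ->
  exists M, forall x s, closure U x -> t <= s <= t + 1 -> u x s <= M.
Proof.
move=> [x0 Ux0] Ub uc t0; pose D := closure U `*` `[t, t + 1].
have D0 : D !=set0.
  exists (x0, t); split => /=; first exact: subset_closure.
  by rewrite in_itv/= lexx lerDl ler01.
have cu : {within D, continuous (fun p : 'rV[R]_n * R => u p.1 p.2)}.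
  apply: continuous_subspaceW uc => p [Dp1 Dp2]; split => //=.
  by move: Dp2; rewrite /= !in_itv/= andbT => /andP[+ _]; exact: le_trans.
have [c _ hc] := compact_EVT_max D0 (compact_cylinder (a := t) (b := t + 1) Ub) cu.
exists (u c.1 c.2) => x s Ux st; apply: (hc (x, s)).
by rewrite inE; split => //=; rewrite in_itv.
Qed.

(* With [w = u ^ (lam + 1) / (lam + 1)], the term [P'(u) (K grad u) . grad u]
   is absorbed by the Hessian of the power as soon as [c1 <= lam * c0], so that
   [w] lies below every supersolution
   [Gam t - sg * expR (k * x_i0 + th * t)] of the resulting linear inequality.
   When [sg = 0] the supersolution has no gradient and no condition on [lam]
   or on the drift is required. *)
Definition comparison_principle (R : realType) (n : nat) (U : set 'rV[R]_n)
  (B : 'rV[R]_n -> R -> R -> 'rV[R]_n) (f u : 'rV[R]_n -> R -> R)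
  (c0 c1 : R) : Prop :=
  forall (lam k th sg z a b : R) (Gam dGam : R -> R) (i0 : 'I_n),
  0 < a -> a <= b -> 0 <= lam -> 0 <= sg -> 0 <= k ->
  sg = 0 \/ [/\ c1 <= lam * c0, th + k * z <= c0 * k ^+ 2 &
    forall x t, U x -> a < t <= b -> enorm (B x t (u x t)) <= z] ->
  {within `[a, b], continuous Gam} ->
  (forall t : R, a < t <= b -> is_derive t 1 Gam (dGam t)) ->
  (forall x t, U x -> a < t <= b -> u x t `^ lam * f x t <= dGam t) ->
  (forall x, closure U x -> u x a `^ (lam + 1) / (lam + 1)
     <= Gam a - sg * expR (k * x 0 i0 + th * a)) ->
  (forall x t, boundary U x -> a <= t <= b ->
     u x t `^ (lam + 1) / (lam + 1) <= Gam t - sg * expR (k * x 0 i0 + th * t)) ->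
  forall x t, closure U x -> a <= t <= b ->
    u x t `^ (lam + 1) / (lam + 1) <= Gam t - sg * expR (k * x 0 i0 + th * t).

(** If the inequality fails, the difference of the two sides, tilted by [- e * (t - a)], has a
    positive maximum on the compact cylinder. The initial and boundary conditions place it inside U
    at a time after [a]. There [touching_source] bounds the time derivative of the untilted
    difference by 0, while maximality in time requires it to be at least [e]. *)
Lemma comparison (R : realType) (n : nat) (U : set 'rV[R]_n)
  (A K : 'rV[R]_n -> R -> 'M[R]_n) (B : 'rV[R]_n -> R -> R -> 'rV[R]_n)
  (f u : 'rV[R]_n -> R -> R) (c0 c1 : R) :
  open U -> bounded_set U -> 0 < c0 ->
  (forall x t, U x -> 0 < t -> (A x t)^T = A x t) ->
  (forall x t xi, U x -> 0 < t ->
     c0 * enorm xi ^+ 2 <= dotv xi (mulmxv (A x t) xi)) ->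
  (forall x t xi, U x -> 0 < t ->
     - c1 * enorm xi ^+ 2 <= dotv xi (mulmxv (K x t) xi)) ->
  continuous_on (closure U `*` `[0, +oo[) u -> C21 U `]0, +oo[ u ->
  (forall x t, U x -> 0 < t -> 0 < u x t) ->
  (forall x t, U x -> 0 < t -> Lop (@ln R) A K B u x t = f x t) ->
  comparison_principle U B f u c0 c1.
Proof.
move=> Uo Ub c00 As ellA ellK uc [_ ud utc uxc uxxc] upos hL
  lam k th sg z a b Gam dGam i0 a0 ab lam0 sg0 k0 hsg
  Gc Gd hG hinit hbd x1 t1 Ux1 /andP[at1 t1b].
rewrite leNgt; apply/negP => hlt.
have lam1 : 0 < lam + 1 by rewrite ltr_wpDl.
pose Psi0 (x : 'rV[R]_n) t := u x t `^ (lam + 1) / (lam + 1)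
  + sg * expR (k * x 0 i0 + th * t) - Gam t.
have P1 : 0 < Psi0 x1 t1 by rewrite /Psi0; lra.
(* Since [t1 - a < b - a + 1], this slope leaves the tilted difference positive at [(x1, t1)]. *)
pose e := Psi0 x1 t1 / (b - a + 1).
have ba1 : 0 < b - a + 1 by rewrite ltr_wpDl// subr_ge0.
have e0 : 0 < e by rewrite divr_gt0.
pose Psi x t := Psi0 x t - e * (t - a).
have P2 : 0 < Psi x1 t1.
  rewrite /Psi subr_gt0 /e mulrAC ltr_pdivrMr// ltr_pM2l//; lra.
have uge0 x t : closure U x -> 0 < t -> 0 <= u x t.
  by move=> Ux t0; exact: solution_ge0 uc upos _ _ Ux t0.
pose D := closure U `*` `[a, b].
have D0 : D !=set0 by exists (x1, t1); split => //=; rewrite in_itv/= at1.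
have cD : compact D by exact: compact_cylinder.
have Dpos p : D p -> 0 < p.2.
  by move=> [_ /=]; rewrite in_itv/= => /andP[+ _]; exact: lt_le_trans.
pose PsiD (p : 'rV[R]_n * R) := `|u p.1 p.2| `^ (lam + 1) / (lam + 1)
  + sg * expR (k * p.1 0 i0 + th * p.2) - Gam p.2 - e * (p.2 - a).
have PsiDE p : D p -> PsiD p = Psi p.1 p.2.
  by move=> Dp; rewrite /PsiD /Psi /Psi0 ger0_norm// uge0//; [case: Dp|exact: Dpos].
have cPsi : {within D, continuous PsiD}.
  have c1' : {within D, continuous (fun p : 'rV[R]_n * R => u p.1 p.2)}.
    apply: continuous_subspaceW uc => p [Dp1 Dp2]; split => //=.
    by move: Dp2; rewrite /= !in_itv/= andbT => /andP[+ _]; apply: le_trans; exact: ltW.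
  have c2' : {within D, continuous (fun p : 'rV[R]_n * R => Gam p.2)}.
    apply/subspace_continuousP => p [Dp1 Dp2].
    move/subspace_continuousP : Gc => /(_ _ Dp2) h Q /h hQ.
    change (nbhs p.2 (fun s => `[a, b]%classic s -> Q (Gam s))) in hQ.
    change (nbhs p (fun q => D q -> Q (Gam q.2))).
    have h' : nbhs p (fun q : 'rV[R]_n * R => `[a, b]%classic q.2 -> Q (Gam q.2)).
      exact: (@cvg_snd _ _ (nbhs p.1) (nbhs p.2) _ _ hQ).
    by apply: (filterS _ h') => q hq [_ Dq]; exact: hq.
  have c3' : continuous (fun p : 'rV[R]_n * R =>
      sg * expR (k * p.1 0 i0 + th * p.2) - e * (p.2 - a)).
    have cx : continuous (fun p : 'rV[R]_n * R => p.1 0 i0).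
      move=> p; apply: (@continuous_comp _ _ _ fst (fun y : 'rV[R]_n => y 0 i0)).
        exact: cvg_fst.
      exact: coord_continuous.
    have ct : continuous (fun p : 'rV[R]_n * R => p.2) by move=> p; exact: cvg_snd.
    have cc (r : R) : continuous (fun p : 'rV[R]_n * R => r) by move=> p; exact: cvg_cst.
    move=> p; apply: cvgB; apply: cvgM.
    - exact: cc.
    - apply: (@continuous_comp _ _ _ (fun p : 'rV[R]_n * R => k * p.1 0 i0 + th * p.2) expR); last exact: continuous_expR.
      apply: cvgD; apply: cvgM; [exact: cc|exact: cx|exact: cc|exact: ct].
    - exact: cc.
    - by apply: cvgB; [exact: ct|exact: cc].
  have c4' : {within D, continuous
      (fun p : 'rV[R]_n * R => `|u p.1 p.2| `^ (lam + 1) * (lam + 1)^-1)}.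
    move=> p; apply: cvgM; last exact: cvg_cst.
    move: p; apply: (@within_continuous_comp _ _ _ D
      (fun p : 'rV[R]_n * R => u p.1 p.2) (fun s => `|s| `^ (lam + 1))) => //.
    by move=> s _; exact: continuous_normr_powR.
  have -> : PsiD = (fun p => `|u p.1 p.2| `^ (lam + 1) * (lam + 1)^-1) +
      (fun p => sg * expR (k * p.1 0 i0 + th * p.2) - e * (p.2 - a)) -
      (fun p => Gam p.2).
    by rewrite /PsiD !fctE; apply/funext => p; ring.
  exact: within_continuousB (within_continuousD c4' (continuous_subspaceT c3')) c2'.
have [[x0 t0] /set_mem D0x0 hmax] := compact_EVT_max D0 cD cPsi.
have {}hmax x t : D (x, t) -> Psi x t <= Psi x0 t0.
  by move=> Dxt; have := hmax (x, t) (mem_set Dxt); rewrite !PsiDE.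
have [/= Ux0] := D0x0; rewrite in_itv/= => /andP[at0 t0b].
have P0 : 0 < Psi x0 t0.
  by apply: lt_le_trans P2 _; apply: hmax; split => //=; rewrite in_itv/= at1.
have t0_gt0 : 0 < t0 by exact: lt_le_trans at0.
have Ux0' : U x0.
  apply/not_notP => nU; have : boundary U x0.
    by split => // /interior_subset.
  move=> /(hbd x0 t0); rewrite at0 t0b => /(_ isT) h.
  have : 0 <= e * (t0 - a) by rewrite mulr_ge0 ?subr_ge0// ltW.
  move: P0; rewrite /Psi /Psi0; lra.
have {}at0 : a < t0.
  rewrite lt_neqAle at0 andbT; apply/eqP => at0E.
  by move: P0; rewrite /Psi /Psi0 -at0E; have := hinit x0 Ux0; lra.
have t0ab : a < t0 <= b by rewrite at0.
pose ux0 := u x0 t0; have ux0_gt0 : 0 < ux0 by exact: upos.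
pose E := sg * expR (k * x0 0 i0 + th * t0).
have hspace v := @touching_space _ n U (u ^~ t0) (fun i y => partial_x i u y t0)
  (fun i j y => partial_x i (partial_x j u) y t0) lam k (th * t0) sg i0 x0 v Uo lam0.
have t0I : `]0, +oo[%classic t0 by rewrite /= in_itv/= andbT.
have {hspace} hspace (v : 'rV[R]_n) :
    ux0 `^ lam * (\sum_(i < n) v 0 i * partial_x i u x0 t0) + E * (k * v 0 i0) = 0 /\
    ux0 `^ lam * (\sum_(j < n) v 0 j * \sum_(i < n) v 0 i * partial_x i (partial_x j u) x0 t0)
    + lam * (ux0 `^ lam / ux0) * (\sum_(i < n) v 0 i * partial_x i u x0 t0) ^+ 2
    + E * (k * v 0 i0) ^+ 2 <= 0.
  apply: hspace => //.
  - by move=> y Uy; exact: upos.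
  - by move=> i y Uy; apply: derivableP; have [_ + _] := ud y t0 Uy t0I; exact.
  - by move=> i y Uy; exact: continuous_slice_open (uxc i) Uy t0I.
  - by move=> i j y Uy; apply: derivableP; have [_ _] := ud y t0 Uy t0I; exact.
  - by move=> i j y Uy; exact: continuous_slice_open (uxxc i j) Uy t0I.
  - move=> y Uy.
    have := hmax y t0 _; rewrite /Psi /Psi0 !lerD2r; apply.
    by split => /=; [exact: subset_closure|rewrite in_itv/= t0b ltW].
have htime : 0 <= ux0 `^ lam * partial_t u x0 t0 + E * th - dGam t0 - e.
  apply: (@derive_ge0_left_max _ (Psi x0) a t0) => //; last first.
    move=> s /andP[as' st]; apply: hmax; split => //=.
    by rewrite in_itv/= as' (le_trans st).
  have d1 : is_derive t0 1 (u x0) (partial_t u x0 t0).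
    by rewrite /partial_t derive1E; apply: derivableP; have [] := ud x0 t0 Ux0' t0I.
  have d2 := is_derive_powR_comp (lam + 1) ux0_gt0 d1.
  have d3 := is_derive_expR_affine (k * x0 0 i0) th t0.
  have d4 := Gd t0 t0ab.
  have -> : Psi x0 = (lam + 1)^-1 \*: (fun s => u x0 s `^ (lam + 1))
     + sg \*: (fun s => expR (k * x0 0 i0 + s * th)) - Gam - e \*: (id - cst a).
    apply/funext => s; rewrite /Psi /Psi0 [th * s]mulrC.
    by rewrite [X in X + _ - _ - _]mulrC.
  apply: is_derive_eq; rewrite /GRing.scale/= addrK subr0 mulr1.
  rewrite !mulrA mulVf ?gt_eqF// mul1r /E [t0 * th]mulrC.
  by rewrite -/ux0; ring.
have gradE (v : 'rV[R]_n) : \sum_(i < n) v 0 i * grad_x u x0 t0 0 i =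
    \sum_(i < n) v 0 i * partial_x i u x0 t0.
  by apply: eq_bigr => i _; rewrite mxE.
have hessE (v : 'rV[R]_n) :
    \sum_(j < n) v 0 j * \sum_(i < n) v 0 i * hess_x u x0 t0 i j =
    \sum_(j < n) v 0 j * \sum_(i < n) v 0 i * partial_x i (partial_x j u) x0 t0.
  by apply: eq_bigr => j _; congr (_ * _); apply: eq_bigr => i _; rewrite mxE.
have hs1 (v : 'rV[R]_n) : ux0 `^ lam * (\sum_(i < n) v 0 i * grad_x u x0 t0 0 i)
    + E * (k * v 0 i0) = 0.
  by rewrite gradE; case: (hspace v).
have hs2 (v : 'rV[R]_n) :
    ux0 `^ lam * (\sum_(j < n) v 0 j * \sum_(i < n) v 0 i * hess_x u x0 t0 i j)
    + lam * (ux0 `^ lam / ux0) * (\sum_(i < n) v 0 i * grad_x u x0 t0 0 i) ^+ 2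
    + E * (k * v 0 i0) ^+ 2 <= 0.
  by rewrite gradE hessE; case: (hspace v).
have E0 : 0 <= E by rewrite mulr_ge0// expR_ge0.
have hE : E = 0 \/ [/\ c1 <= lam * c0, enorm (B x0 t0 ux0) <= z &
    th + k * z <= c0 * k ^+ 2].
  case: hsg => [sg00|[h1 h2 h3]]; first by left; rewrite /E sg00 mul0r.
  by right; split => //; exact: h3.
have := hL x0 t0 Ux0' t0_gt0.
rewrite /Lop derive1E; have [_ ->] := is_derive1_ln ux0_gt0.
move=> /(touching_source (As x0 t0 Ux0' t0_gt0) c00 lam0 (powR_gt0 lam ux0_gt0)
  ux0_gt0 E0 k0 (ellA x0 t0 ^~ Ux0' ^~ t0_gt0) (ellK x0 t0 ^~ Ux0' ^~ t0_gt0) hs1 hs2 hE).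
have := hG x0 t0 Ux0' t0ab; rewrite -/ux0.
by move: htime e0; lra.
Qed.

(** * Integrals and suprema *)

Lemma integral_itvcy_le (R : realType) (q : R -> R) (T M : R) :
  measurable_fun `[T, +oo[ q -> (forall s, T <= s -> 0 <= q s) ->
  (forall n : nat,
    (\int[lebesgue_measure]_(s in `[T, (T + n%:R)%R]) (q s)%:E <= M%:E)%E) ->
  (\int[lebesgue_measure]_(s in `[T, +oo[) (q s)%:E <= M%:E)%E.
Proof.
move=> mq q0 hM.
have sub n : `[T, T + n%:R]%classic `<=` `[T, +oo[%classic.
  by move=> s /=; rewrite !in_itv/= andbT => /andP[].
rewrite itv_bndy_bigcup_BRight.
have cv : (\int[lebesgue_measure]_(s in `[T, (T + n%:R)%R]) (q s)%:E)%E @[n --> \oo] -->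
    (\int[lebesgue_measure]_(s in \bigcup_n `[T, (T + n%:R)%R]%classic) (q s)%:E)%E.
  apply: ge0_nondecreasing_set_cvg_integral.
  - apply/nondecreasing_seqP => n; apply/subsetPset => s /=.
    rewrite !in_itv/= => /andP[-> /le_trans]; apply.
    by rewrite lerD2l ler_nat.
  - by [].
  - by move=> n; apply/measurable_EFinP; exact: measurable_funS mq.
  - by move=> n s /sub /=; rewrite in_itv/= andbT lee_fin; exact: q0.
rewrite -(cvg_lim _ cv)//; apply: lime_le; first by apply/cvg_ex; eexists; exact: cv.
exact: nearW.
Qed.

Lemma integral_itvcc_step (R : realType) (q : R -> R) (T s r c : R) :
  T <= s -> s <= r -> measurable_fun `[T, r] q ->
  (forall x, T <= x -> 0 <= q x) -> (forall x, s <= x <= r -> q x <= c) ->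
  (\int[lebesgue_measure]_(x in `[T, r]) (q x)%:E <=
   \int[lebesgue_measure]_(x in `[T, s]) (q x)%:E + (c * (r - s))%:E)%E.
Proof.
move=> Ts sr mq q0 qc.
have mE : measurable_fun `[T, r] (fun x => (q x)%:E) by exact/measurable_EFinP.
have E : `[T, r]%classic = `[T, s] `|` `]s, r].
  by apply: itv_bndbnd_setU; rewrite bnd_simp.
rewrite {1}E ge0_integral_setU//.
- apply: leeD2l.
  have [sr'|rs] := ltP s r; last first.
    have -> : r = s by apply/eqP; rewrite eq_le rs sr.
    by rewrite set_itvoc0 integral_set0 subrr mulr0.
  apply: (@le_trans _ _ (\int[lebesgue_measure]_(x in `]s, r]) (cst c%:E x))%E).
    apply: ge0_le_integral => //.
    + by move=> x /=; rewrite in_itv/= => /andP[sx _]; rewrite lee_fin q0// (le_trans Ts)// ltW.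
    + apply: measurable_funS mE => // x /=; rewrite !in_itv/= => /andP[sx ->].
      by rewrite (le_trans Ts)// ltW.
    + move=> x /=; rewrite in_itv/= => /andP[sx xr]; rewrite lee_fin; apply: qc.
      by rewrite ltW.
  rewrite integral_cst//= lebesgue_measure_itv/= lte_fin sr'.
  by rewrite -EFinD -EFinM.
- by rewrite -E.
- move=> x; rewrite -E /= in_itv/= => /andP[Tx _]; by rewrite lee_fin q0.
- apply/disj_setPRL => x /=; rewrite !in_itv/= => /andP[sx _] /andP[_ xs].
  by move: (lt_le_trans sx xs); rewrite ltxx.
Qed.

(** The integral up to [t0 + N] is at most a left Riemann sum with unit step plus [t0 - T]; the
    latter covers the initial stretch, where [q <= 1] replaces monotonicity. *)
Lemma sum_unbounded_of_integral (R : realType) (q : R -> R) (T t0 M : R) :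
  T <= t0 -> measurable_fun `[T, +oo[ q ->
  (forall s, T <= s -> 0 <= q s <= 1) ->
  (forall s r, t0 <= s -> s <= r -> q r <= q s) ->
  (\int[lebesgue_measure]_(s in `[T, +oo[) (q s)%:E = +oo)%E ->
  exists N : nat, M <= \sum_(i < N) q (t0 + i%:R).
Proof.
move=> Tt0 mq q01 qdecr qoo; apply/not_existsP => hN.
have q0 s : T <= s -> 0 <= q s by move=> /q01 /andP[].
have mqr r : measurable_fun `[T, r] q.
  by apply: measurable_funS mq => // s /=; rewrite !in_itv/= andbT => /andP[].
have step (N : nat) : (\int[lebesgue_measure]_(s in `[T, (t0 + N%:R)%R]) (q s)%:E <=
   (t0 - T + \sum_(i < N) q (t0 + i%:R))%:E)%E.
  elim: N => [|N IH].
    rewrite big_ord0 !addr0.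
    have := @integral_itvcc_step _ q T T t0 1 (lexx _) Tt0 (mqr _) q0.
    rewrite set_itv1 integral_set1 add0e mul1r; apply => s /andP[Ts _].
    by have /andP[] := q01 s Ts.
  have tN : t0 <= t0 + N%:R by rewrite lerDl.
  have tN1 : t0 + N%:R <= t0 + N.+1%:R by rewrite lerD2l ler_nat.
  apply: le_trans (@integral_itvcc_step _ q T (t0 + N%:R) _ (q (t0 + N%:R)) _ tN1
    (mqr _) q0 _) _.
  - exact: le_trans tN.
  - by move=> s /andP[sN _]; exact: qdecr.
  have -> : t0 + N.+1%:R - (t0 + N%:R) = 1 :> R by rewrite -addn1 natrD; ring.
  rewrite mulr1 big_ord_recr/= addrA EFinD; exact: leeD2r.
have : (\int[lebesgue_measure]_(s in `[T, +oo[) (q s)%:E <= (t0 - T + M)%:E)%E.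
  apply: integral_itvcy_le => // n.
  apply: (@le_trans _ _ (\int[lebesgue_measure]_(s in `[T, (t0 + n%:R)%R]) (q s)%:E)%E).
    apply: ge0_subset_integral => //.
    - by apply/measurable_EFinP; exact: mqr.
    - by move=> s /=; rewrite in_itv/= => /andP[Ts _]; rewrite lee_fin q0.
    - move=> s /=; rewrite !in_itv/= => /andP[-> /le_trans]; apply.
      by rewrite lerD2r.
  apply: le_trans (step n) _; rewrite lee_fin lerD2l.
  by have := hN n => /negP; rewrite -ltNge => /ltW.
by rewrite qoo.
Qed.

(** The derivative is obtained in the open interval only, whereas [comparison_principle] asks for it
    at the final time too; so [b] is taken beyond that time in each application. The last clause
    transfers bounds on extended-real integrals to the real primitive. *)
Lemma primitive_spec (R : realType) (h : R -> R) (a b : R) :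
  a < b -> {within `[a, b], continuous h} -> (forall s, a <= s <= b -> 0 <= h s) ->
  exists Gam : R -> R,
  [/\ {within `[a, b], continuous Gam},
      forall t : R, a < t < b -> is_derive t 1 Gam (h t),
      forall t, a <= t <= b -> 0 <= Gam t &
      forall t r M, a <= t <= r -> r <= b ->
        (\int[lebesgue_measure]_(s in `[a, r]) (h s)%:E <= M%:E)%E -> Gam t <= M].
Proof.
move=> ab ch h0.
have ih : lebesgue_measure.-integrable `[a, b] (EFin \o h).
  by apply: continuous_compact_integrable => //; exact: segment_compact.
exists (fun t => \int[lebesgue_measure]_(s in `[a, t]) h s); split.
- exact: (parameterized_integral_continuous (ltW ab) ih).
- move=> t /andP[at' tb].
  have ct : {for t, continuous h}.
    by apply: (within_continuous_continuous ab ch); rewrite in_itv/= at' tb.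
  have [d1 d2] := continuous_FTC1_closed tb ih at' ct.
  by apply: DeriveDef; [exact: d1|rewrite -derive1E; exact: d2].
- move=> t /andP[at' tb]; apply: Rintegral_ge0 => s /=; rewrite in_itv/= => /andP[as' st].
  by apply: h0; rewrite as' (le_trans st).
- move=> t r M /andP[at' tr] rb hM.
  have it : lebesgue_measure.-integrable `[a, t] (EFin \o h).
    apply: integrableS ih => // s /=; rewrite !in_itv/= => /andP[-> st].
    by rewrite (le_trans st)// (le_trans tr).
  rewrite -lee_fin /Rintegral fineK ?integrable_fin_num//.
  apply: le_trans hM; apply: ge0_subset_integral => //.
  - have : measurable_fun `[a, b] (EFin \o h) by exact: measurable_int ih.
    apply: measurable_funS => // s /=; rewrite !in_itv/= => /andP[-> sr].
    by rewrite (le_trans sr).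
  - move=> s /=; rewrite in_itv/= => /andP[as' sr]; rewrite lee_fin h0//.
    by rewrite as' (le_trans sr).
  - by move=> s /=; rewrite !in_itv/= => /andP[-> /le_trans]; apply.
Qed.

Lemma max_over_norm_ge0 (R : realType) (T : Type) (D : set T) (h : T -> R) :
  0 <= max_over D (fun p => `|h p|).
Proof.
rewrite /max_over; have [hs|hs] := pselect (has_sup [set `|h p| | p in D]).
  have [[y [p Dp _]] _] := hs.
  apply: (@le_trans _ _ `|h p|) => //.
  by apply: sup_upper_bound => //; exists p.
(* A supremum that does not exist has the default value 0. *)
by rewrite sup_out.
Qed.

Lemma limf_esup0_near (R : realType) (h : R -> R) (e : R) :
  limf_esup (fun t => (h t)%:E) (pinfty_nbhs R) = 0%E -> 0 < e ->
  exists T : R, forall t, T < t -> h t < e.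
Proof.
move=> h0 e0.
have : (limf_esup (fun t => (h t)%:E) (pinfty_nbhs R) < e%:E)%E by rewrite h0 lte_fin.
rewrite /limf_esup => /ereal_inf_lt[_ [V [M [_ MV]] <-] VE].
exists M => t Mt; rewrite -lte_fin; apply: le_lt_trans VE.
by apply: ereal_sup_ubound; exists t => //; exact: MV.
Qed.

Lemma closure_coord_bound (R : realType) (n : nat) (U : set 'rV[R]_n) :
  bounded_set U ->
  exists2 rho : R, 0 < rho & forall x i, closure U x -> `|x 0 i| <= rho.
Proof.
move=> /bounded_closure [M [Mr hM]].
exists (`|M| + 1); first by rewrite ltr_wpDl.
move=> x i Ux; apply: (@le_trans _ _ `|x|); last first.
  by apply: hM Ux; rewrite (le_lt_trans (ler_norm M))// ltrDl.
rewrite [leRHS]/Num.norm /= mx_normrE; apply/bigmax_geP; right.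
by exists (0, i).
Qed.

(** Positivity allows division by the diameter in the choice of [mu]. *)
Lemma diameter_gt0 (R : realType) (n : nat) (U : set 'rV[R]_n) :
  (1 <= n)%N -> U !=set0 -> open U -> bounded_set U -> 0 < diameter U.
Proof.
move=> n1 [x Ux] Uo Ub.
pose i0 : 'I_n := Ordinal n1.
have [rho rho0 hrho] := closure_coord_bound Ub.
have /nbhs_ballP [r /= r0 hr] : nbhs x U by exact: open_nbhs_nbhs.
pose v : 'rV[R]_n := (r / 2 / (`|delta_mx 0 i0 : 'rV[R]_n| + 1)) *: delta_mx 0 i0.
have M0 : 0 < `|delta_mx 0 i0 : 'rV[R]_n| + 1 by rewrite ltr_wpDl.
have Uv : U (x + v).
  apply: hr; rewrite -ball_normE /ball_/= opprD addrA subrr sub0r normrN normrZ.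
  rewrite ger0_norm ?divr_ge0 ?(ltW r0) ?(ltW M0)//.
  rewrite mulrAC ltr_pdivrMr// ltr_pM ?divr_ge0 ?(ltW r0)//.
    by rewrite ltr_pdivrMr// ltr_pMr// ltr1n.
  by rewrite ltrDl.
have v0 : 0 < enorm v.
  apply: lt_le_trans (ler_coord_enorm v i0).
  rewrite normr_gt0 !mxE !eqxx mulr1 gt_eqF// !divr_gt0//.
apply: lt_le_trans v0 _; rewrite /diameter /max_over.
apply: sup_upper_bound; last first.
  exists (x + v, x) => /=; first by split; apply: subset_closure.
  by rewrite addrAC subrr add0r.
split.
  by exists (enorm (x - x)), (x, x) => //=; split; apply: subset_closure.
exists (Num.sqrt (\sum_(i < n) (2 * rho) ^+ 2)) => _ [[y z] [/= Uy Uz] <-].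
rewrite ler_sqrt ?sumr_ge0//; last by move=> i _; rewrite sqr_ge0.
apply: ler_sum => i _; rewrite -expr2 -ler_sqrt ?sqr_ge0// !sqrtr_sqr.
rewrite [leRHS]gtr0_norm ?mulr_gt0// !mxE.
apply: le_trans (ler_normB _ _) _.
by rewrite mulr_natl mulr2n lerD// hrho.
Qed.

(** * Growth estimates *)

(** Here [E t] is [s] times the exponential of [k * (X - rho) + th * (t - t0)]. As [X] varies over a
    range of length at most [2 * rho], the speed [th] brings the exponent from at most 0 at [t0] to
    at least [k >= 1] at [t0 + 1], and the exponential of a number [y >= 1] is at least
    [1 + y >= 2]. *)
Lemma barrier_bounds (R : realType) (k rho s t0 t X : R) :
  1 <= k -> 0 < rho -> 0 <= s -> `|X| <= rho -> t0 <= t <= t0 + 1 ->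
  let th := k * (2 * rho + 1) in
  let E t := s * expR (- (k * rho) - th * t0) * expR (k * X + th * t) in
  [/\ E t0 <= s, E t <= s * expR th, 0 <= E t & 2 * s <= E (t0 + 1)].
Proof.
move=> k1 rho0 s0; rewrite ler_norml => /andP[X1 X2] /andP[t01 t02] th E.
have k0 : 0 < k by exact: lt_le_trans k1.
have th0 : 0 < th by rewrite mulr_gt0// addr_gt0// mulr_gt0.
have EE r : E r = s * expR (k * (X - rho) + th * (r - t0)).
  by rewrite /E -mulrA -expRD; congr (_ * expR _); ring.
have kX : k * (X - rho) <= 0.
  by apply: mulr_ge0_le0; [exact: ltW|rewrite subr_le0].
rewrite !EE; split.
- rewrite subrr mulr0 addr0 ler_piMr// -expR0 ler_expR//.
- rewrite ler_wpM2l// ler_expR.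
  have : th * (t - t0) <= th * 1 by rewrite ler_pM2l// lerBlDl.
  lra.
- by rewrite mulr_ge0// expR_ge0.
- rewrite mulrC ler_wpM2l//.
  have -> : k * (X - rho) + th * (t0 + 1 - t0) = k * (X + rho) + k.
    by rewrite /th; ring.
  apply: le_trans (expR_ge1Dx _).
  have : 0 <= k * (X + rho) by apply: mulr_ge0; [exact: ltW|lra].
  lra.
Qed.

(** With [eta = kap * q (t + 1)], a step sends [a] to [a - (a - 2 * e) * eta]: the excess over
    [2 * e] is multiplied by [1 - eta], which is at most [expR (- eta)]. *)
Lemma decay_iteration (R : realType) (P : R -> R -> Prop) (q : R -> R)
  (kap e s T : R) :
  0 < kap -> 0 < e -> 0 <= s ->
  (forall t a b, P t a -> a <= b -> P t b) ->
  (forall t a, T <= t -> 2 * e <= a -> P t a ->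
    P (t + 1) (a + e * (kap * q (t + 1)) - (a - e) * (kap * q (t + 1)))) ->
  P T (2 * e + s) ->
  forall j : nat, P (T + j%:R)
    (2 * e + s * expR (- (kap * \sum_(i < j) q (T + 1 + i%:R)))).
Proof.
move=> kap0 e0 s0 Pm step P0; elim=> [|j IH].
  by rewrite big_ord0 mulr0 oppr0 expR0 mulr1 addr0.
set S := \sum_(i < j) _ in IH.
have s1 : 0 <= s * expR (- (kap * S)) by rewrite mulr_ge0// expR_ge0.
have := step _ _ _ _ IH; rewrite lerDl lerDl => /(_ (ler0n _ _) s1).
have -> : T + j.+1%:R = T + j%:R + 1 by rewrite -addn1 natrD addrA.
move=> /Pm; apply; rewrite big_ord_recr/= -/S.
have -> : T + j%:R + 1 = T + 1 + j%:R by rewrite addrAC.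
rewrite mulrDr opprD expRD [s * (_ * _)]mulrA.
set eta := kap * q _; set w := s * _ in s1 *.
have -> : 2 * e + w + e * eta - (2 * e + w - e) * eta = 2 * e + w * (1 - eta).
  by ring.
by rewrite lerD2l ler_wpM2l// expR_ge1Dx.
Qed.

(** This is comparison with [lam = 0] and [sg = 0]: the power is [u] itself, and [m] plus a
    primitive of [F] is a supersolution constant in space. *)
Lemma source_bound (R : realType) (n : nat) (U : set 'rV[R]_n)
  (B : 'rV[R]_n -> R -> R -> 'rV[R]_n) (f u : 'rV[R]_n -> R -> R)
  (c0 c1 a t m M : R) (F : R -> R) (i0 : 'I_n) :
  comparison_principle U B f u c0 c1 -> 0 < a -> a <= t ->
  (forall x s, closure U x -> 0 < s -> 0 <= u x s) ->
  {within `[0, +oo[, continuous F} -> (forall s, 0 <= s -> 0 <= F s) ->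
  (forall x s, U x -> 0 < s -> `|f x s| <= F s) ->
  (forall x, closure U x -> u x a <= m) ->
  (forall x s, boundary U x -> a <= s -> u x s <= m) ->
  (\int[lebesgue_measure]_(s in `[a, t]) (F s)%:E <= M%:E)%E ->
  forall x, closure U x -> u x t <= m + M.
Proof.
move=> comp a0 at' uge0 cF F0 fF um ubd intM x Ux.
have t0 : 0 < t by exact: lt_le_trans at'.
have cF1 : {within `[a, t + 1], continuous F}.
  apply: continuous_subspaceW cF => s /=; rewrite !in_itv/= andbT => /andP[+ _].
  by apply: le_trans; exact: ltW.
have at1 : a < t + 1 by rewrite (le_lt_trans at')// ltrDl.
have F1 s : a <= s <= t + 1 -> 0 <= F s.
  by move=> /andP[Ts _]; rewrite F0// (le_trans _ Ts)// ltW.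
have [Gam [cG dG G0 GM]] := primitive_spec at1 cF1 F1.
have p1 (v : R) : 0 <= v -> v `^ (0 + 1) / (0 + 1) = v.
  by move=> v0; rewrite add0r powRr1// divr1.
have tt1 : t <= t + 1 by rewrite lerDl.
have E0 y s : 0 * expR (0 * (y : 'rV[R]_n) 0 i0 + 0 * s) = 0 by rewrite mul0r.
have H1 : {within `[a, t], continuous (fun s => m + Gam s)}.
  move=> s; apply: cvgD; first exact: cvg_cst.
  move: s; apply: continuous_subspaceW cG => s /=; rewrite !in_itv/= => /andP[-> st].
  exact: le_trans tt1.
have H2 (s : R) : a < s <= t -> is_derive s 1 (fun s => m + Gam s) (F s).
  move=> /andP[s1 s2].
  have hs := dG s (ltac:(by rewrite s1 (le_lt_trans s2)// ltrDl)).
  have -> : (fun s => m + Gam s) = cst m + Gam by [].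
  by apply: is_derive_eq; rewrite add0r.
have H3 y s : U y -> a < s <= t -> u y s `^ 0 * f y s <= F s.
  move=> Uy /andP[s1 _]; rewrite powRr0 mul1r.
  by apply: le_trans (ler_norm _) _; apply: fF => //; exact: lt_trans s1.
have GTa : 0 <= Gam a by apply: G0; rewrite lexx ltW.
have H4 y : closure U y -> u y a `^ (0 + 1) / (0 + 1) <=
    m + Gam a - 0 * expR (0 * y 0 i0 + 0 * a).
  by move=> Uy; rewrite p1 ?uge0// E0 subr0 ler_wpDr// um.
have H5 y s : boundary U y -> a <= s <= t -> u y s `^ (0 + 1) / (0 + 1) <=
    m + Gam s - 0 * expR (0 * y 0 i0 + 0 * s).
  move=> By /andP[s1 s2]; rewrite p1 ?uge0//; last 2 first.
  - by case: By.
  - exact: lt_le_trans s1.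
  by rewrite E0 subr0 ler_wpDr ?ubd// G0// s1 (le_trans s2).
have := comp 0 0 0 0 0 a t _ _ i0 a0 at' (lexx _) (lexx _) (lexx _)
  (or_introl erefl) H1 H2 H3 H4 H5 x t Ux.
rewrite at' lexx => /(_ isT).
rewrite p1 ?uge0// E0 subr0 => /le_trans; apply; rewrite lerD2l.
by apply: (GM t t M) => //; rewrite at' lexx.
Qed.

(* The barrier [sg * exp (k * x_i0 + th * t)] is at most 1 (in suitable units)
   at time [t0] and at least 2 at time [t0 + 1]: this gap turns a bound [a] at
   time [t0] into a strictly better one at time [t0 + 1]. *)
Lemma growth_step (R : realType) (n : nat) (U : set 'rV[R]_n)
  (B : 'rV[R]_n -> R -> R -> 'rV[R]_n) (f u : 'rV[R]_n -> R -> R)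
  (c0 c1 lam z rho t0 a e M : R) (H : R -> R) (i0 : 'I_n) :
  comparison_principle U B f u c0 c1 ->
  0 < c0 -> 0 <= lam -> c1 <= lam * c0 -> 0 <= z -> 0 < rho -> 0 < t0 ->
  e <= a ->
  (forall x, closure U x -> `|x 0 i0| <= rho) ->
  {within `[t0, t0 + 2], continuous H} ->
  (forall s, t0 <= s <= t0 + 2 -> 0 <= H s) ->
  (\int[lebesgue_measure]_(s in `[t0, (t0 + 1)%R]) (H s)%:E <= M%:E)%E ->
  (forall x s, U x -> t0 < s <= t0 + 1 -> u x s `^ lam * f x s <= H s) ->
  (forall x s, U x -> t0 < s <= t0 + 1 -> enorm (B x s (u x s)) <= z) ->
  (forall x s, boundary U x -> t0 <= s <= t0 + 1 ->
    u x s `^ (lam + 1) / (lam + 1) <= e) ->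
  (forall x, closure U x -> u x t0 `^ (lam + 1) / (lam + 1) <= a) ->
  let eta := expR (- (((z + (2 * rho + 1)) / c0 + 1) * (2 * rho + 1))) in
  (forall x s, closure U x -> t0 <= s <= t0 + 1 ->
    u x s `^ (lam + 1) / (lam + 1) <= a + M + (a - e) * eta) /\
  (forall x, closure U x ->
    u x (t0 + 1) `^ (lam + 1) / (lam + 1) <= a + M - (a - e) * eta).
Proof.
move=> comp c00 lam0 hc z0 rho0 t00 ea hrho cH H0 intM hf hB hbd hin.
set D := 2 * rho + 1 => eta; have D0 : 0 < D by rewrite addr_gt0// mulr_gt0.
(* With [th = k * D], the barrier condition [th + k * z <= c0 * k ^+ 2] amounts to
   [D + z <= c0 * k]; the added 1 gives [k >= 1]. *)
pose k := (z + D) / c0 + 1.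
have k1 : 1 <= k.
  by rewrite lerDr; apply: divr_ge0; [apply: addr_ge0 => //; exact: ltW|exact: ltW].
have k0 : 0 < k by exact: lt_le_trans k1.
(* As [eta = expR (- th)], the barrier stays below [s0 * expR th = a - e], so subtracting it from
   [a + s0] leaves at least [e] on the lateral boundary. It is at most [s0] at time [t0], which
   leaves at least [a], and at least [2 * s0] at time [t0 + 1], which is the gain. *)
pose th := k * D; pose s0 := (a - e) * eta.
have eta0 : 0 < eta by exact: expR_gt0.
have s00 : 0 <= s0 by rewrite mulr_ge0 ?subr_ge0// ltW.
have s0th : s0 * expR th = a - e.
  by rewrite /s0 /eta -mulrA -expRD addNr expR0 mulr1.
pose sg := s0 * expR (- (k * rho) - th * t0).
have sg0 : 0 <= sg by rewrite mulr_ge0// expR_ge0.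
have t02 : t0 < t0 + 2 by rewrite ltrDl.
have t01 : t0 <= t0 + 1 by rewrite lerDl.
have t12 : t0 + 1 < t0 + 2 by rewrite ltrD2l ltr1n.
have [Gam [cG dG G0 GM]] := primitive_spec t02 cH H0.
have bb x s : closure U x -> t0 <= s <= t0 + 1 ->
    [/\ sg * expR (k * x 0 i0 + th * t0) <= s0,
     sg * expR (k * x 0 i0 + th * s) <= s0 * expR th,
     0 <= sg * expR (k * x 0 i0 + th * s) &
     2 * s0 <= sg * expR (k * x 0 i0 + th * (t0 + 1))].
  by move=> Ux hs; exact: (barrier_bounds k1 rho0 s00 (hrho _ Ux) hs).
have bb0 x : closure U x -> sg * expR (k * x 0 i0 + th * t0) <= s0.
  by move=> Ux; have [] := bb x t0 Ux (ltac:(by rewrite lexx)).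
have H1 : {within `[t0, t0 + 1], continuous (fun s => a + s0 + Gam s)}.
  move=> s; apply: cvgD; first exact: cvg_cst.
  move: s; apply: continuous_subspaceW cG => s /=; rewrite !in_itv/= => /andP[-> st].
  by rewrite (le_trans st)// ltW.
have H2 (s : R) : t0 < s <= t0 + 1 -> is_derive s 1 (fun s => a + s0 + Gam s) (H s).
  move=> /andP[s1 s2].
  have hs := dG s (ltac:(by rewrite s1 (le_lt_trans s2)//)).
  have -> : (fun s => a + s0 + Gam s) = cst (a + s0) + Gam by [].
  by apply: is_derive_eq; rewrite add0r.
have Gt0 : 0 <= Gam t0 by apply: G0; rewrite lexx ltW.
have H4 x : closure U x -> u x t0 `^ (lam + 1) / (lam + 1) <=
    a + s0 + Gam t0 - sg * expR (k * x 0 i0 + th * t0).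
  by move=> Ux; have := hin x Ux; have := bb0 x Ux; lra.
have H5 x s : boundary U x -> t0 <= s <= t0 + 1 ->
    u x s `^ (lam + 1) / (lam + 1) <=
    a + s0 + Gam s - sg * expR (k * x 0 i0 + th * s).
  move=> bx hs; have Ux : closure U x by case: bx.
  have [_ h _ _] := bb x s Ux hs.
  have Gs : 0 <= Gam s.
    by move/andP: hs => [h1 h2]; apply: G0; rewrite h1 (le_trans h2)// ltW.
  have := hbd x s bx hs; move: h; rewrite s0th; lra.
have hk : sg = 0 \/ [/\ c1 <= lam * c0, th + k * z <= c0 * k ^+ 2 &
    forall x s, U x -> t0 < s <= t0 + 1 -> enorm (B x s (u x s)) <= z].
  right; split => //.
  rewrite /th -mulrDr expr2 mulrCA ler_wpM2l ?(ltW k0)// /k mulrDr mulrCA.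
  by rewrite mulfV ?gt_eqF// !mulr1 addrC lerDl ltW.
have key x s : closure U x -> t0 <= s <= t0 + 1 ->
    u x s `^ (lam + 1) / (lam + 1) <=
    a + s0 + M - sg * expR (k * x 0 i0 + th * s).
  move=> Ux hs.
  apply: le_trans (comp lam k th sg z t0 (t0 + 1) _ _ i0 t00 t01 lam0 sg0 (ltW k0)
    hk H1 H2 hf H4 H5 x s Ux hs) _.
  rewrite lerD2r lerD2l; apply: (GM s (t0 + 1) M) => //; exact: ltW.
split=> [x s Ux hs|x Ux].
  have := key x s Ux hs; have [_ _ h _] := bb x s Ux hs.
  by move: h; rewrite -/s0; lra.
have hs : t0 <= t0 + 1 <= t0 + 1 by rewrite t01 lexx.
have := key x _ Ux hs; have [_ _ _ h] := bb x _ Ux hs.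
by move: h; rewrite -/s0; lra.
Qed.

(** * Decay to zero: fixing times, constants and [mu], then iterating *)

Unset Implicit Arguments.

Theorem theorem5p11 (R : realType) (n : nat) (hn : (1 <= n)%N)
  (U : set 'rV[R]_n) (hU0 : U !=set0) (hUo : open U) (hUb : bounded_set U)
  (A K : 'rV[R]_n -> R -> 'M[R]_n) (B : 'rV[R]_n -> R -> R -> 'rV[R]_n)
  (c0 M1 c1 c2 : R) (hc0 : 0 < c0) (hM1 : 0 < M1) (hc1 : 0 <= c1)
  (hc2 : 0 <= c2)
  (hAsym : forall (x : 'rV[R]_n) (t : R), U x -> 0 < t -> (A x t)^T = A x t)
  (hAell : forall (x : 'rV[R]_n) (t : R) (xi : 'rV[R]_n), U x -> 0 < t ->
     c0 * enorm xi ^+ 2 <= dotv xi (mulmxv (A x t) xi))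
  (hAtr : forall (x : 'rV[R]_n) (t : R), U x -> 0 < t -> \tr (A x t) <= M1)
  (hK : forall (x : 'rV[R]_n) (t : R) (xi : 'rV[R]_n), U x -> 0 < t ->
     - c1 * enorm xi ^+ 2 <= dotv xi (mulmxv (K x t) xi)
       <= c2 * enorm xi ^+ 2)
  (f g : 'rV[R]_n -> R -> R) (u0 : 'rV[R]_n -> R)
  (u : 'rV[R]_n -> R -> R)
  (huC : continuous_on (closure U `*` `[0, +oo[) u)
  (huC21 : C21 U `]0, +oo[ u)
  (huJ : forall (x : 'rV[R]_n) (t : R), U x -> 0 < t -> 0 < u x t)
  (hLu : forall (x : 'rV[R]_n) (t : R), U x -> 0 < t ->
     Lop (@ln R) A K B u x t = f x t)
  (hug : forall (x : 'rV[R]_n) (t : R), boundary U x -> 0 < t -> u x t = g x t)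
  (hu0 : forall x, U x -> u x 0 = u0 x)
  (bbar : R -> R) (gamma0 : R)
  (hbC : {within `[0, +oo[, continuous bbar})
  (hb0 : forall t : R, 0 <= t -> 0 <= bbar t)
  (hbincr : increasing_on `[0, +oo[ bbar)
  (hbinfty : bbar t @[t --> +oo] --> +oo)
  (hgamma0 : 0 < gamma0)
  (hB : forall (x : 'rV[R]_n) (t s : R), U x -> 0 < t -> 0 < s ->
     enorm (B x t s) <= bbar t * (1 + `|s|) `^ gamma0)
  (F : R -> R)
  (hFC : {within `[0, +oo[, continuous F})
  (hF0 : forall t : R, 0 <= t -> 0 <= F t)
  (hfF : forall (x : 'rV[R]_n) (t : R), U x -> 0 < t -> `|f x t| <= F t)
  (hFint : (\int[lebesgue_measure]_(tau in `[0%R, +oo[) (F tau)%:E = +oo)%E)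
  (lambda1 : R) (hlambda1 : 0 < lambda1) (hlambda1c : c1 / c0 <= lambda1)
  (* calF and Lamt are defined on [T0, +oo[ *)
  (T0 : R) (hT0 : 0 <= T0) (calF Lamt : R -> R)
  (hcalFC : {within `[T0, +oo[, continuous calF})
  (hLamtC : {within `[T0, +oo[, continuous Lamt})
  (hcalFincr : increasing_on `[T0, +oo[ calF)
  (hcalF : \forall t \near +oo,
     (\int[lebesgue_measure]_(tau in `[0%R, t]) (F tau)%:E <= (calF t)%:E)%E)
  (hLamtdecr : decreasing_on `[T0, +oo[ Lamt)
  (hLamt : \forall t \near +oo,
     ((max_over (boundary U `*` `[t, (t + 1)%R])
         (fun p : 'rV[R]_n * R => `|g p.1 p.2|%R))%:E
      + \int[lebesgue_measure]_(tau in `[t, (t + 1)%R])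
          (F tau * calF tau `^ lambda1)%:E
      <= (Lamt t)%:E)%E)
  (hZ : forall mu : R, 0 < mu ->
     let z0 := fun t : R => mu * bbar t * calF t `^ gamma0 in
     let Lambar := fun t : R => Lamt (t / 4) in
     condition_Z (diameter U) c0 T0 (4 * T0) z0 Lambar /\
     limf_esup (fun t : R => (Lambar t * expR (diameter U / c0 * z0 t))%:E)
       (pinfty_nbhs R) = 0%E) :
  max_over (closure U) (fun x => u x t) @[t --> +oo] --> (0 : R).
Proof.
have hK' x t xi : U x -> 0 < t ->
    - c1 * enorm xi ^+ 2 <= dotv xi (mulmxv (K x t) xi).
  by move=> Ux t0; have /andP[] := hK x t xi Ux t0.
have comp := comparison hUo hUb hc0 hAsym hAell hK' huC huC21 huJ hLu.
pose i0 : 'I_n := Ordinal hn.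
have [rho rho0 hrho] := closure_coord_bound hUb.
have d0 : 0 < diameter U by exact: diameter_gt0.
set d := diameter U in hZ d0.
have uge0 := solution_ge0 huC huJ.
have hbmono s t : 0 <= s -> s <= t -> bbar s <= bbar t.
  move=> s0 st; apply: hbincr => //; rewrite inE/= in_itv/= andbT//.
  exact: le_trans st.
have hcmono s t : T0 <= s -> s <= t -> calF s <= calF t.
  move=> s0 st; apply: hcalFincr => //; rewrite inE/= in_itv/= andbT//.
  exact: le_trans st.
have hLmono s t : T0 <= s -> s <= t -> Lamt t <= Lamt s.
  move=> s0 st; apply: hLamtdecr => //; rewrite inE/= in_itv/= andbT//.
  exact: le_trans st.
have [T1 [_ hT1]] := hcalF; have [T2 [_ hT2]] := hLamt.
pose Ta := T0 + `|T1| + `|T2| + 1.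
have TaT0 : T0 <= Ta by rewrite /Ta -!addrA lerDl !addr_ge0.
have TaT1 : T1 < Ta.
  rewrite /Ta; have := ler_norm T1; have := normr_ge0 T2; lra.
have TaT2 : T2 < Ta.
  rewrite /Ta; have := ler_norm T2; have := normr_ge0 T1; lra.
have Ta1 : 1 <= Ta by rewrite /Ta lerDr !addr_ge0.
have Ta0 : 0 < Ta by exact: lt_le_trans Ta1.
have mF : measurable_fun `[0 : R, +oo[ F.
  by apply: subspace_continuous_measurable_fun.
have mEF (a r : R) : 0 <= a ->
    measurable_fun `[a, r] (fun s => (F s)%:E).
  move=> a0; apply/measurable_EFinP; apply: measurable_funS mF => // s /=.
  by rewrite !in_itv/= andbT => /andP[/(le_trans a0)].
have cT1 t : Ta <= t ->
    (\int[lebesgue_measure]_(s in `[0%R, t]) (F s)%:E <= (calF t)%:E)%E.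
  by move=> tt; apply: hT1; exact: lt_le_trans tt.
have calF_ge0 t : Ta <= t -> 0 <= calF t.
  move=> /cT1; rewrite -lee_fin; apply: le_trans.
  by apply: integral_ge0 => s /=; rewrite in_itv/= lee_fin => /andP[s0 _]; exact: hF0.
have calF_infty M : exists2 T, Ta <= T & forall t, T <= t -> M <= calF t.
  suff [m hm] : exists m : nat,
      (M%:E < \int[lebesgue_measure]_(s in `[0%R, (0 + m%:R)%R]) (F s)%:E)%E.
    exists (Ta + m%:R); first by rewrite lerDl.
    move=> t tm; rewrite -lee_fin; apply: le_trans (cT1 t _); last first.
      by apply: le_trans tm; rewrite lerDl.
    apply: le_trans (ltW hm) _; apply: ge0_subset_integral => //.
    - exact: mEF.
    - by move=> s /=; rewrite in_itv/= lee_fin => /andP[s0 _]; exact: hF0.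
    - move=> s /=; rewrite !in_itv/= => /andP[-> /le_trans]; apply.
      by rewrite add0r; apply: le_trans tm; rewrite lerDr ltW.
  apply/not_existsP => hM.
  have : (\int[lebesgue_measure]_(s in `[0%R, +oo[) (F s)%:E <= M%:E)%E.
    apply: integral_itvcy_le => // m.
    by have := hM m => /negP; rewrite -leNgt.
  by rewrite hFint.
have intL t : Ta <= t ->
    0 <= Lamt t /\ (\int[lebesgue_measure]_(s in `[t, (t + 1)%R])
      (F s * calF s `^ lambda1)%:E <= (Lamt t)%:E)%E /\
    max_over (boundary U `*` `[t, t + 1]) (fun p => `|g p.1 p.2|) <= Lamt t.
  move=> tt; have := hT2 t (lt_le_trans TaT2 tt).
  set I := (\int[_]_(_ in _) _)%E; set m := max_over _ _.
  have m0 : 0 <= m by exact: max_over_norm_ge0.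
  have I0 : (0 <= I)%E.
    apply: integral_ge0 => s /=; rewrite in_itv/= => /andP[ts _].
    rewrite lee_fin mulr_ge0 ?powR_ge0// hF0//.
    by apply: le_trans ts; apply: le_trans tt; rewrite ltW.
  move=> h; split; last split.
  - by rewrite -lee_fin; apply: le_trans h; rewrite adde_ge0.
  - by apply: le_trans h; rewrite leeDr.
  - by rewrite -lee_fin; apply: le_trans h; rewrite leeDl.
have ucyl t : 0 < t -> exists M, forall x s, closure U x -> t <= s <= t + 1 -> u x s <= M.
  by move=> t0; apply: solution_cylinder_bound => //; exact: ltW.
have ubd x t : boundary U x -> Ta <= t -> u x t <= Lamt t.
  move=> bx tt; have t0 : 0 < t by exact: lt_le_trans tt.
  have [_ [_]] := intL t tt; apply: le_trans.
  have Ux : closure U x by case: bx.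
  rewrite -[leLHS]ger0_norm ?uge0// hug//.
  apply: sup_upper_bound; last first.
    by exists (x, t) => //; split => //=; rewrite in_itv/= lexx lerDl ler01.
  (* The [sup] dominates [g] only if the values of [g] are bounded; they are values of [u], which is
     bounded on the compact cylinder. *)
  split; first by exists `|g x t|, (x, t) => //; split => //=; rewrite in_itv/= lexx lerDl ler01.
  have [M hM] := ucyl t t0; exists M => _ [[y s] [/= by_]] + <-.
  rewrite in_itv/= => /andP[ts st1].
  have s0 : 0 < s by exact: lt_le_trans ts.
  have Uy : closure U y by case: by_.
  by rewrite -hug// ger0_norm ?uge0// hM// ts.
(* [C] dominates [u] at time [Ta] and, as [Lamt] decreases, all later boundary values. *)
have [C C0 hC] : exists2 C, 0 <= C &
    forall x t, closure U x -> Ta <= t -> u x t <= C + calF t.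
  have [m hm] := ucyl Ta Ta0; exists (`|m| + Lamt Ta).
    by rewrite addr_ge0//; have [] := intL Ta (lexx _).
  have mL : 0 <= Lamt Ta by have [] := intL Ta (lexx _).
  move=> x t Ux tt; apply: (source_bound (F := F) i0 comp Ta0 tt uge0 hFC hF0 hfF) => //.
  - move=> y Uy; have : u y Ta <= m by apply: hm; rewrite // lexx lerDl ler01.
    have := ler_norm m; lra.
  - move=> y s By Ts; have : u y s <= Lamt s by exact: ubd.
    have : Lamt s <= Lamt Ta by exact: hLmono.
    have := normr_ge0 m; lra.
  apply: le_trans (cT1 t tt); apply: ge0_subset_integral => //.
  - exact: mEF.
  - by move=> s /=; rewrite in_itv/= lee_fin => /andP[s0 _]; exact: hF0.
  - move=> s /=; rewrite !in_itv/= => /andP[sT ->]; rewrite andbT.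
    by apply: le_trans sT; exact: ltW.
(* Beyond [Tb] the constants are absorbed: [C + calF t + 1 <= 2 * calF t]. *)
have [Tb TbTa hTb] := calF_infty (C + 1).
have Tb0 : 0 < Tb by exact: lt_le_trans TbTa.
have TbT0 : T0 <= Tb by exact: le_trans TbTa.
have u2F x t : closure U x -> Tb <= t -> u x t + 1 <= 2 * calF t.
  move=> Ux tt; have := hC x t Ux (le_trans TbTa tt); have := hTb t tt; lra.
have cF0 t : Tb <= t -> 0 <= calF t by move=> tt; apply/calF_ge0/(le_trans TbTa).
pose g2 : R := 2 `^ gamma0; have g20 : 0 < g2 by exact: powR_gt0.
pose D := 2 * rho + 1; have D0 : 0 < D by rewrite addr_gt0// mulr_gt0.
pose zz t := g2 * bbar t * calF t `^ gamma0.
have bb0 t : Tb <= t -> 0 <= bbar t.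
  by move=> tt; apply: hb0; apply: le_trans tt; exact: ltW.
have zz0 t : Tb <= t -> 0 <= zz t.
  by move=> tt; rewrite !mulr_ge0 ?powR_ge0 ?bb0 ?(ltW g20).
have zzmono s t : Tb <= s -> s <= t -> zz s <= zz t.
  move=> ss st; have tt := le_trans ss st.
  apply: ler_pM; rewrite ?powR_ge0 ?mulr_ge0 ?(ltW g20) ?bb0//.
    by rewrite ler_pM2l// hbmono// (le_trans _ ss)// ltW.
  apply: ge0_ler_powR; rewrite ?nnegrE ?cF0 ?(ltW hgamma0)//.
  by apply: hcmono => //; exact: le_trans ss.
have drift x s t : U x -> Tb <= s -> s <= t -> enorm (B x s (u x s)) <= zz t.
  move=> Ux ss st; apply: le_trans (zzmono s t ss st).
  have s0 : 0 < s by exact: lt_le_trans ss.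
  have Ux' : closure U x by exact: subset_closure.
  apply: le_trans (hB _ _ _ Ux s0 (huJ _ _ Ux s0)) _.
  rewrite /zz [g2 * _]mulrC -mulrA ler_wpM2l ?bb0// /g2 -powRM ?cF0//.
  apply: ge0_ler_powR; rewrite ?nnegrE ?(ltW hgamma0) ?mulr_ge0 ?cF0 ?addr_ge0//.
  by rewrite ger0_norm ?uge0// addrC u2F.
(* This choice turns [d / c0 * z0] into [D / c0 * zz], so that [q] is exactly the time-dependent
   factor of the contraction rate. *)
pose mu := D * g2 / d.
have mu0 : 0 < mu by rewrite divr_gt0// mulr_gt0.
have [[_ _ [Tst [_ [_ [[Tst0 TstT0] _ _ hqoo _]]]]] hls] := hZ mu mu0.
pose q t := expR (- (d / c0 * (mu * bbar t * calF t `^ gamma0))).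
have qE t : q t = expR (- (D / c0 * zz t)).
  rewrite /q /mu /zz; congr (expR (- _)); field.
  by rewrite !gt_eqF.
have q0 t : 0 < q t by exact: expR_gt0.
have q1 t : T0 <= t -> q t <= 1.
  move=> tt; rewrite /q -expR0 ler_expR oppr_le0.
  apply: mulr_ge0; first by apply: divr_ge0; exact: ltW.
  apply: mulr_ge0; last exact: powR_ge0.
  by apply: mulr_ge0; [exact: ltW|apply: hb0; exact: le_trans tt].
have qmono s t : Tb <= s -> s <= t -> q t <= q s.
  move=> ss st; rewrite !qE ler_expR lerN2 ler_pM2l ?divr_gt0//; exact: zzmono.
have mq : measurable_fun `[Tst, +oo[ q.
  have sub (a : R) : a <= Tst -> `[Tst, +oo[%classic `<=` `[a, +oo[%classic.
    by move=> aT s /=; rewrite !in_itv/= !andbT; exact: le_trans.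
  have mb : measurable_fun `[Tst, +oo[ bbar.
    apply: measurable_funS (sub 0 Tst0) _ => //.
    exact: subspace_continuous_measurable_fun.
  have mc : measurable_fun `[Tst, +oo[ calF.
    apply: measurable_funS (sub T0 TstT0) _ => //.
    exact: subspace_continuous_measurable_fun.
  apply: measurableT_comp => //; apply: measurableT_comp => //.
  apply: measurable_funM => //; apply: measurable_funM.
    by apply: measurable_funM.
  exact: (measurableT_comp (measurable_powR gamma0) mc).
(* The upper limit is read at time [4 * s], where the rescaled function takes the value [Lamt s];
   then [s + 1 <= 4 * s] and [q] decreases. *)
have hLq e : 0 < e -> exists2 T, Tb <= T & forall s, T <= s -> Lamt s <= e * q (s + 1).
  move=> e0; have [T hT] := limf_esup0_near hls e0.
  exists (Tb + 1 + `|T|); first by rewrite -addrA lerDl addr_ge0.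
  move=> s ss; have sT : T < 4 * s by have := ler_norm T; have := normr_ge0 T; lra.
  have s4 : Tb <= 4 * s by have := normr_ge0 T; lra.
  have s1 : s + 1 <= 4 * s by have := normr_ge0 T; lra.
  have sTb : Tb <= s by have := normr_ge0 T; lra.
  have := hT _ sT; rewrite [4 * s / 4](_ : _ = s); last by field.
  rewrite -[X in _ * expR X]opprK expRN -/(q (4 * s)) ltr_pdivrMr// => /ltW h.
  apply: le_trans h _; rewrite ler_pM2l//; apply: qmono => //.
  by rewrite (le_trans sTb)// lerDl.
have lam1 : 0 < lambda1 + 1 by rewrite addr_gt0.
pose kap := expR (- ((D / c0 + 1) * D)).
have kap0 : 0 < kap by exact: expR_gt0.
have kap1 : kap <= 1.
  rewrite /kap -expR0 ler_expR oppr_le0.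
  apply: mulr_ge0; last exact: ltW.
  by apply: addr_ge0 => //; apply: divr_ge0; exact: ltW.
have etaE t : expR (- (((zz t + D) / c0 + 1) * D)) = kap * q t.
  rewrite qE -expRD; congr expR; field; by rewrite gt_eqF.
pose l2 : R := 2 `^ lambda1; have l20 : 0 < l2 by exact: powR_gt0.
have hc : c1 <= lambda1 * c0 by rewrite -ler_pdivrMr.
(* The three entries of the minimum make the boundary values of [u] at most 1, so that raising to
   the power [lambda1 + 1] does not increase them, then keep them at most [e], and finally bound the
   source [l2 * Lamt t0] by [e * (kap * q (t0 + 1))]. *)
have step e T : 0 < e -> Tb <= T ->
    (forall s, T <= s -> Lamt s <= Num.min 1 (Num.min e (e * kap / l2)) * q (s + 1)) ->
  forall t0 a, T <= t0 -> e <= a ->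
  (forall x, closure U x -> u x t0 `^ (lambda1 + 1) / (lambda1 + 1) <= a) ->
  (forall x s, closure U x -> t0 <= s <= t0 + 1 ->
    u x s `^ (lambda1 + 1) / (lambda1 + 1) <=
    a + e * (kap * q (t0 + 1)) + (a - e) * (kap * q (t0 + 1))) /\
  (forall x, closure U x ->
    u x (t0 + 1) `^ (lambda1 + 1) / (lambda1 + 1) <=
    a + e * (kap * q (t0 + 1)) - (a - e) * (kap * q (t0 + 1))).
  move=> e0 TT hT t0 a Tt0 ea hin; rewrite -etaE.
  have tb0 : Tb <= t0 by exact: le_trans Tt0.
  have ta0 : Ta <= t0 by exact: le_trans tb0.
  have t00 : 0 < t0 by exact: lt_le_trans ta0.
  have tb1 : Tb <= t0 + 1 by rewrite (le_trans tb0)// lerDl.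
  have hm := hT t0 Tt0; set m := Num.min 1 _ in hm.
  have m1 : m <= 1 by rewrite /m ge_min lexx.
  have me : m <= e by rewrite /m !ge_min lexx orbT.
  have mk : m <= e * kap / l2 by rewrite /m !ge_min lexx !orbT.
  have m0 : 0 < m by rewrite /m !lt_min ltr01 e0 divr_gt0// mulr_gt0.
  have q11 : q (t0 + 1) <= 1.
    by apply: q1; rewrite (le_trans TbT0).
  have Lm : Lamt t0 <= m.
    by apply: le_trans hm _; rewrite ler_piMr// ltW.
  have [_ [intM _]] := intL t0 ta0.
  pose H s := l2 * (F s * `|calF s| `^ lambda1).
  have cF2 : {within `[t0, t0 + 2], continuous F}.
    apply: continuous_subspaceW hFC => s /=; rewrite !in_itv/= andbT => /andP[+ _].
    by apply: le_trans; exact: ltW.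
  have cc2 : {within `[t0, t0 + 2], continuous calF}.
    apply: continuous_subspaceW hcalFC => s /=; rewrite !in_itv/= andbT => /andP[+ _].
    by apply: le_trans; exact: le_trans tb0.
  have cp2 : {within `[t0, t0 + 2], continuous (fun s => `|calF s| `^ lambda1)}.
    apply: (@within_continuous_comp _ _ _ _ calF (fun s => `|s| `^ lambda1)) => //.
    by move=> s _; exact: continuous_normr_powR.
  have cH : {within `[t0, t0 + 2], continuous H}.
    move=> s; apply: cvgM; first exact: cvg_cst.
    by apply: cvgM; [exact: cF2|exact: cp2].
  have F0 s : t0 <= s -> 0 <= F s.
    by move=> ss; apply: hF0; rewrite (le_trans _ ss)// ltW.
  have H0 s : t0 <= s <= t0 + 2 -> 0 <= H s.
    by move=> /andP[ss _]; rewrite !mulr_ge0 ?powR_ge0 ?F0 ?(ltW l20).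
  have intH : (\int[lebesgue_measure]_(s in `[t0, (t0 + 1)%R]) (H s)%:E
      <= (l2 * Lamt t0)%:E)%E.
    have -> : (\int[lebesgue_measure]_(s in `[t0, (t0 + 1)%R]) (H s)%:E =
      l2%:E * \int[lebesgue_measure]_(s in `[t0, (t0 + 1)%R])
        (F s * calF s `^ lambda1)%:E)%E.
      rewrite -ge0_integralZl_EFin//; last 3 first.
      - move=> s /=; rewrite in_itv/= => /andP[ss _].
        by rewrite lee_fin mulr_ge0 ?powR_ge0 ?F0.
      - apply/measurable_EFinP; apply: measurable_funM.
          by apply: measurable_funS mF => // s /=; rewrite !in_itv/= andbT =>
            /andP[ss _]; rewrite (le_trans _ ss)// ltW.
        apply: (measurableT_comp (measurable_powR lambda1)).
        apply: subspace_continuous_measurable_fun => //.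
        apply: continuous_subspaceW cc2 => s /=; rewrite !in_itv/= => /andP[-> ss].
        by rewrite (le_trans ss)// lerD2l ler1n.
      - exact: ltW.
      apply: eq_integral => s; rewrite inE/= in_itv/= => /andP[ss _].
      by rewrite /H ger0_norm ?EFinM// cF0// (le_trans tb0).
    by rewrite EFinM; apply: lee_wpmul2l => //; rewrite lee_fin ltW.
  have hf x s : U x -> t0 < s <= t0 + 1 -> u x s `^ lambda1 * f x s <= H s.
    move=> Ux /andP[s1 s2]; have s0 : 0 < s by exact: lt_trans s1.
    have Ux' : closure U x by exact: subset_closure.
    have bs : Tb <= s by rewrite (le_trans tb0)// ltW.
    rewrite /H mulrCA [leRHS]mulrC ger0_norm ?cF0// /l2 -powRM ?cF0//.
    apply: (@le_trans _ _ (u x s `^ lambda1 * F s)).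
      by rewrite ler_wpM2l ?powR_ge0// (le_trans (ler_norm _))// hfF.
    rewrite ler_wpM2r ?F0 ?(ltW s1)//; apply: ge0_ler_powR.
    - exact: ltW.
    - by rewrite nnegrE uge0.
    - by rewrite nnegrE mulr_ge0 ?cF0.
    - by have := u2F x s Ux' bs; lra.
  have hd x s : U x -> t0 < s <= t0 + 1 -> enorm (B x s (u x s)) <= zz (t0 + 1).
    by move=> Ux /andP[s1 s2]; apply: drift => //; rewrite (le_trans tb0)// ltW.
  have hbd x s : boundary U x -> t0 <= s <= t0 + 1 ->
      u x s `^ (lambda1 + 1) / (lambda1 + 1) <= e.
    move=> bx /andP[s1 s2]; have Ux : closure U x by case: bx.
    have um : u x s <= m.
      apply: le_trans (ubd x s bx (le_trans ta0 s1)) _; apply: le_trans Lm.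
      by apply: hLmono => //; exact: le_trans tb0.
    apply: (@le_trans _ _ (u x s `^ (lambda1 + 1))).
      by rewrite ler_pdivrMr// ler_peMr ?powR_ge0// lerDr ltW.
    apply: le_trans me; apply: (le_trans _ um).
    have : 0 <= u x s by apply: uge0 => //; exact: lt_le_trans s1.
    rewrite le_eqVlt => /orP[/eqP <-|us0]; first by rewrite powR0// gt_eqF.
    by apply: ge1r_powR; [rewrite us0 (le_trans um)|rewrite lerDr ltW].
  have [k1 k2] := growth_step comp hc0 (ltW hlambda1) hc (zz0 _ tb1) rho0 t00 ea
    (fun x Ux => hrho x i0 Ux) cH H0 intH hf hd hbd hin.
  have lM : l2 * Lamt t0 <= e * expR (- (((zz (t0 + 1) + D) / c0 + 1) * D)).
    rewrite etaE; apply: (@le_trans _ _ (l2 * ((e * kap / l2) * q (t0 + 1)))).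
      rewrite ler_pM2l//; apply: le_trans hm _.
      by rewrite ler_pM2r.
    rewrite le_eqVlt; apply/orP; left; apply/eqP; field; by rewrite gt_eqF.
  split=> [x s Ux hs|x Ux].
    by apply: le_trans (k1 x s Ux hs) _; rewrite !lerD2r lerD2l.
  by apply: le_trans (k2 x Ux) _; rewrite !lerD2r lerD2l.
have decay eps : 0 < eps -> exists T, 0 < T /\
    forall x t, closure U x -> T <= t -> u x t <= eps.
  move=> eps0; pose l1 := lambda1 + 1.
  (* Eventually the bound [a] at the times [T + j] is at most [3 * e], and between them it can grow
     at most to [2 * a]; hence the 6. *)
  pose e := eps `^ l1 / l1 / 6.
  have e0 : 0 < e by rewrite !divr_gt0// powR_gt0.
  have e1 : 0 < Num.min 1 (Num.min e (e * kap / l2)).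
    by rewrite !lt_min ltr01 e0 divr_gt0// mulr_gt0.
  have [T' TTb' hT'] := hLq _ e1.
  (* The added term puts [T + 1] beyond [Tst], from where the integral of [q] diverges. *)
  pose T := T' + `|Tst|; have TT' : T' <= T by rewrite lerDl.
  have TTb : Tb <= T by exact: le_trans TT'.
  have hT r (Tr : T <= r) := hT' r (le_trans TT' Tr).
  have T0' : 0 < T by exact: lt_le_trans TTb.
  have stepT := step e T e0 TTb hT.
  pose P t a := forall x, closure U x -> u x t `^ l1 / l1 <= a.
  pose s := (C + calF T) `^ l1 / l1.
  have s0 : 0 <= s by rewrite divr_ge0 ?powR_ge0// ltW.
  have CF0 : 0 <= C + calF T by rewrite addr_ge0// cF0.
  have P0 : P T (2 * e + s).
    move=> x Ux; apply: (@le_trans _ _ s); last by rewrite lerDr mulr_ge0// ltW.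
    rewrite /s ler_pM2r ?invr_gt0//; apply: ge0_ler_powR.
    - exact: ltW.
    - by rewrite nnegrE uge0.
    - by rewrite nnegrE.
    - by apply: hC => //; exact: le_trans TTb.
  have Pj := @decay_iteration _ P q kap e s T kap0 e0 s0 _ _ P0.
  have {}Pj j : P (T + j%:R)
      (2 * e + s * expR (- (kap * \sum_(i < j) q (T + 1 + i%:R)))).
    apply: Pj => [t a b Pa ab x Ux|t a Tt ea Pa].
      by apply: le_trans ab; exact: Pa.
    have ea' : e <= a by apply: le_trans ea; rewrite ler_peMl ?ler1n// ltW.
    by have [_] := stepT t a Tt ea' Pa.
  have TT1 : Tst <= T + 1.
    by have := ler_norm Tst; have := le_trans (ltW Tb0) TTb'; rewrite /T; lra.
  (* Since an exponential exceeds its exponent, this threshold brings [s] times the product of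
     contraction factors below [e]. *)
  have [N hN] : exists N : nat, s / (e * kap) <= \sum_(i < N) q (T + 1 + i%:R).
    apply: (sum_unbounded_of_integral (s / (e * kap)) TT1 mq _ _ hqoo).
      by move=> r Tr; rewrite (ltW (q0 r)) q1// (le_trans TstT0).
    move=> r1 r2 Tr; apply: qmono; apply: le_trans Tr.
    by apply: le_trans TTb _; rewrite lerDl.
  exists (T + N%:R); split; first by rewrite ltr_wpDr.
  move=> x t Ux tN.
  have tT : 0 <= t - T by rewrite subr_ge0 (le_trans _ tN)// lerDl.
  (* The iteration controls only the times [T + j]; the first half of [step] covers the rest of each
     unit interval. *)
  pose j := Num.truncn (t - T).
  have /andP[j1 j2] : j%:R <= t - T < j.+1%:R by exact: truncn_itv.
  have Nj : (N <= j)%N.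
    by rewrite -ltnS -(ltr_nat R); apply: le_lt_trans j2; rewrite lerBrDl.
  set a := 2 * e + s * expR (- (kap * \sum_(i < j) q (T + 1 + i%:R))).
  have a2 : 2 * e <= a by rewrite lerDl mulr_ge0// expR_ge0.
  have a3 : a <= 3 * e.
    suff : s * expR (- (kap * \sum_(i < j) q (T + 1 + i%:R))) <= e by rewrite /a; lra.
    rewrite expRN ler_pdivrMr ?expR_gt0//.
    apply: (@le_trans _ _ (e * (kap * \sum_(i < N) q (T + 1 + i%:R)))).
      by move: hN; rewrite (ler_pdivrMr _ _ (mulr_gt0 e0 kap0)) [leRHS]mulrC mulrA.
    rewrite ler_pM2l//.
    apply: (@le_trans _ _ (kap * \sum_(i < j) q (T + 1 + i%:R))).
      rewrite ler_pM2l// -(subnKC Nj) big_split_ord/= lerDl.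
      by apply: sumr_ge0 => i _; rewrite ltW.
    by apply: le_trans (expR_ge1Dx _); rewrite lerDr.
  have tj : T + j%:R <= t <= T + j%:R + 1.
    rewrite -lerBrDl j1/= -addrA -lerBlDl -[1]/(1%:R) -natrD addn1; exact: ltW.
  have Tj : T <= T + j%:R by rewrite lerDl.
  have ea : e <= a by apply: le_trans a2; rewrite ler_peMl ?ler1n// ltW.
  have [h _] := stepT _ a Tj ea (Pj j).
  have := h x t Ux tj; set eta := kap * q _ => hu.
  have eta0 : 0 < eta by rewrite mulr_gt0.
  have eta1 : eta <= 1.
    have qj : q (T + j%:R + 1) <= 1.
      by apply: q1; rewrite -addrA (le_trans TbT0)// (le_trans TTb)// lerDl addr_ge0.
    by rewrite /eta mulr_ile1// ltW.
  have : u x t `^ l1 / l1 <= eps `^ l1 / l1.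
    apply: le_trans hu _.
    have -> : eps `^ l1 / l1 = 6 * e by rewrite /e; field; rewrite gt_eqF.
    have : e * eta <= e by rewrite ler_piMr// ltW.
    have : (a - e) * eta <= a - e by rewrite ler_piMr// subr_ge0.
    lra.
  rewrite ler_pM2r ?invr_gt0// => hp.
  have t0 : 0 < t by apply: lt_le_trans tN; rewrite ltr_wpDr.
  rewrite leNgt; apply/negP => /(gt0_ltr_powR lam1).
  rewrite !nnegrE uge0 ?(ltW eps0)// => /(_ isT isT).
  by rewrite ltNge hp.
have [x0 Ux0] := hU0; have Ux0' : closure U x0 by exact: subset_closure.
apply/cvgrPdist_le => eps eps0; have [T [T0' hT]] := decay eps eps0.
exists T; split; first exact: num_real.
move=> t Tt; have t0 : 0 < t by exact: lt_trans Tt.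
have hs : has_sup ((fun x => u x t) @` closure U).
  split; first by exists (u x0 t), x0.
  by exists eps => _ [x Ux <-]; apply: hT => //; exact: ltW.
rewrite sub0r normrN ger0_norm.
  by apply: ge_sup; [exists (u x0 t), x0|move=> _ [x Ux <-]; apply: hT => //; exact: ltW].
apply: (@le_trans _ _ (u x0 t)); first exact: uge0.
by apply: sup_upper_bound => //; exists x0.
Qed.
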